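(* Let $1\leq p\leq q\leq \infty$, and let $E$ be a locally convex space. Then the following assertions are equivalent: (i) if $L$ is a normed space and $T:L\to E$ is an operator such that $T^\ast: E'_{w^\ast} \to L'_\beta$ is $(q,p)$-convergent, then $T$ is weakly sequentially compact (resp., sequentially compact, weakly sequentially precompact, sequentially precompact, weakly sequentially $p$-compact or weakly sequentially $p$-precompact); (ii) the same as (i) with $L=\ell_1^0$, i.e. if $T:\ell_1^0\to E$ is an operator such that $T^\ast: E'_{w^\ast} \to (\ell_1^0)'_\beta$ is $(q,p)$-convergent, then $T$ is weakly sequentially compact (resp., of the corresponding class in (i)); (iii) each $(p,q)$-limited subset of $E$ is relatively weakly sequentially compact (resp., relatively sequentially compact, weakly sequentially precompact, sequentially precompact, relatively weakly sequentially $p$-compact or weakly sequentially $p$-precompact). Moreover, if $E$ is locally complete, then (i)--(iii) are equivalent to (iv) the same as (i) with $L=\ell_1$, i.e. if $T:\ell_1\to E$ is an operator such that $T^\ast: E'_{w^\ast} \to (\ell_1)'_\beta$ is $(q,p)$-convergent, then $T$ is weakly sequentially compact (resp., of the corresponding class in (i)).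
   Context: All locally convex spaces (lcs) are Hausdorff, over $\mathbb{F}\in\{\mathbb{R},\mathbb{C}\}$; $\omega=\{0,1,2,\dots\}$; ''operator'' means continuous linear map. $E'$ is the topological dual of $E$; $E'_{w^\ast}=(E',\sigma(E',E))$; $L'_\beta$ is the strong dual (the dual Banach space if $L$ is normed); $T^\ast(\chi)=\chi\circ T$. $\ell_1^0$ is the linear span of the canonical unit vectors in $\ell_1$ with the $\ell_1$-norm. $E$ is locally complete if the closed absolutely convex hull of each null sequence in $E$ is compact. A sequence $\{x_n\}_{n\in\omega}$ in an lcs $F$ is weakly $p$-summable if $(\langle\chi,x_n\rangle)_n\in\ell_p$ (or $\in c_0$ if $p=\infty$) for every $\chi\in F'$; weakly $p$-convergent to $x\in F$ if $\{x_n-x\}$ is weakly $p$-summable; weakly $p$-Cauchy if for each pair of strictly increasing sequences $(k_n),(j_n)\subseteq\omega$, the sequence $\{x_{k_n}-x_{j_n}\}_n$ is weakly $p$-summable. A linear map $R:F\to G$ between lcs is $(q,p)$-convergent if it sends weakly $p$-summable sequences in $F$ to strongly $q$-summable sequences in $G$; here $\{y_n\}$ in $G$ is strongly $q$-summable if $(\rho(y_n))_n\in\ell_q$ (or $\in c_0$ if $q=\infty$) for every continuous seminorm $\rho$ on $G$ (for normed $G$: $(\|y_n\|)_n\in\ell_q$, or $\in c_0$). A subset $A$ of $E$ is: relatively (weakly) sequentially compact if every sequence in $A$ has a subsequence (weakly) converging to a point of $E$; (weakly) sequentially precompact if every sequence in $A$ has a (weakly) Cauchy subsequence; relatively weakly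 sequentially $p$-compact if every sequence in $A$ has a subsequence weakly $p$-convergent to a point of $E$; weakly sequentially $p$-precompact if every sequence in $A$ has a weakly $p$-Cauchy subsequence. An operator $T:L\to E$ is weakly sequentially compact (resp., sequentially compact, weakly sequentially precompact, sequentially precompact, weakly sequentially $p$-compact, weakly sequentially $p$-precompact) if there is a neighborhood $U$ of zero in $L$ such that $T(U)$ is a relatively weakly sequentially compact (resp., relatively sequentially compact, weakly sequentially precompact, sequentially precompact, relatively weakly sequentially $p$-compact, weakly sequentially $p$-precompact) subset of $E$. A non-empty subset $A$ of $E$ is $(p,q)$-limited if $\big(\sup_{a\in A}|\langle\chi_n,a\rangle|\big)_n\in\ell_q$ (or $\in c_0$ if $q=\infty$) for every weakly $p$-summable sequence $\{\chi_n\}$ in $E'_{w^\ast}$. *)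

(* Defs.v *)
From HB Require Import structures.
From mathcomp Require Import all_boot all_order all_algebra.
From mathcomp Require Import all_classical all_reals all_analysis.
From mathcomp Require Import complex.

Set Implicit Arguments.
Unset Strict Implicit.
Unset Printing Implicit Defensive.

Import Order.TTheory GRing.Theory Num.Theory.
Import numFieldNormedType.Exports.

Local Open Scope classical_set_scope.
Local Open Scope ring_scope.

Variant scalars := RealScalars | ComplexScalars.

Definition scalar_field (R : realType) (s : scalars) : numFieldType :=
  match s with
  | RealScalars => R
  | ComplexScalars => R[i]
  end.

(* The norm `|a| of a scalar lives in the scalar field itself; [modulus a] is
   the same number as an element of R, and [of_real] embeds R back. *)
Definition modulus (R : realType) (s : scalars) : scalar_field R s -> R :=
  match s return scalar_field R s -> R with
  | RealScalars => fun x => `|x|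
  | ComplexScalars => fun z => complex.Re `|z|
  end.

Definition of_real (R : realType) (s : scalars) : R -> scalar_field R s :=
  match s return R -> scalar_field R s with
  | RealScalars => fun x => x
  | ComplexScalars => fun x => real_complex R x
  end.

Section modulus_theory.
Variables (R : realType) (s : scalars).
Local Notation K := (scalar_field R s).
Implicit Types (a b : K) (x y : R).

Lemma of_real_modulus a : of_real s (modulus a) = `|a|.
Proof. by case: s a => //= a. Qed.

Lemma of_realD x y : of_real s (x + y) = of_real s x + of_real s y.
Proof. by case: s => //=; rewrite rmorphD. Qed.

Lemma of_realM x y : of_real s (x * y) = of_real s x * of_real s y.
Proof. by case: s => //=; rewrite rmorphM. Qed.

Lemma ler_of_real x y : (of_real s x <= of_real s y) = (x <= y).
Proof. by case: s => //=; rewrite lecR. Qed.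

Lemma of_real_inj : injective (@of_real R s).
Proof. by case: s => //=; exact: complexI. Qed.

Lemma of_real0 : of_real s (0 : R) = 0.
Proof. by case: s => //=; rewrite rmorph0. Qed.

Lemma modulus_le a b : (modulus a <= modulus b) = (`|a| <= `|b|).
Proof. by rewrite -ler_of_real !of_real_modulus. Qed.

Lemma modulus_ge0 a : 0 <= modulus a.
Proof. by rewrite -ler_of_real of_real0 of_real_modulus. Qed.

Lemma modulus0 : modulus (0 : K) = 0.
Proof. by apply: of_real_inj; rewrite of_real_modulus of_real0 normr0. Qed.

Lemma modulus_eq0 a : modulus a = 0 -> a = 0.
Proof.
move=> a0; apply/eqP; rewrite -normr_eq0 -of_real_modulus a0.
by rewrite of_real0.
Qed.

Lemma modulusD a b : modulus (a + b) <= modulus a + modulus b.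
Proof. by rewrite -ler_of_real of_realD !of_real_modulus ler_normD. Qed.

Lemma modulusM a b : modulus (a * b) = modulus a * modulus b.
Proof. by apply: of_real_inj; rewrite of_realM !of_real_modulus normrM. Qed.

End modulus_theory.

Section dual_space.
Variables (K : numFieldType) (E : tvsType K).

Definition linear_continuous : {pred (E -> K^o)} :=
  [pred f | `[< linear f /\ continuous f >]].

Lemma linear_continuousP f :
  reflect (linear f /\ continuous f) (f \in linear_continuous).
Proof. exact: asboolP. Qed.

Record dual := Dual {
  dual_fun :> E -> K^o ;
  _ : dual_fun \in linear_continuous }.

HB.instance Definition _ := [isSub for dual_fun].
HB.instance Definition _ := [Choice of dual by <:].

Lemma linear_continuous_submod_closed : submod_closed linear_continuous.
Proof.
split.
  apply/linear_continuousP; split=> [a x y|x]; last exact: cvg_cst.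
  by rewrite /= scaler0 addr0.
move=> a f g /linear_continuousP[lf cf] /linear_continuousP[lg cg].
apply/linear_continuousP; split=> [b x y|x].
  transitivity (a *: f (b *: x + y) + g (b *: x + y)); first by [].
  rewrite lf lg !scalerDr !scalerA [a * b]mulrC addrACA.
  by rewrite -!scalerA -scalerDr.
apply: (@cvgD _ K^o _ _ _ (fun y => a *: f y)); last exact: cg.
exact: (@cvgZl_tmp _ K^o _ _ _ _ f _ (cf x)).
Qed.

HB.instance Definition _ := GRing.isSubmodClosed.Build K (E -> K^o)
  linear_continuous linear_continuous_submod_closed.
HB.instance Definition _ := [SubChoice_isSubLmodule of dual by <:].

Lemma dual_linear (chi : dual) : linear chi.
Proof. by case: chi => f /= /linear_continuousP[]. Qed.

Lemma dual_continuous (chi : dual) : continuous chi.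
Proof. by case: chi => f /= /linear_continuousP[]. Qed.

HB.instance Definition _ (chi : dual) :=
  GRing.isLinear.Build K E K^o _ (dual_fun chi) (dual_linear chi).

Definition dual_eval (x : E) (chi : dual) : K^o := chi x.

Lemma dual_eval_linear x : linear (dual_eval x).
Proof. by []. Qed.

HB.instance Definition _ (x : E) :=
  GRing.isLinear.Build K dual K^o _ (dual_eval x) (dual_eval_linear x).

End dual_space.

(* [weak_lcs f] is the vector space V with the coarsest vector space topology
   that makes all the functionals f i continuous. *)
Definition weak_lcs (K : numFieldType) (V : lmodType K) (I : Type)
  (f : I -> {linear V -> K^o}) : Type := V.

Section weak_lcs_topology.
Variables (K : numFieldType) (V : lmodType K) (I : Type).
Variable f : I -> {linear V -> K^o}.
Local Notation W := (weak_lcs f).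

HB.instance Definition _ := GRing.Lmodule.on W.

Definition weak_ball (x : W) (n : nat) (i : 'I_n -> I) (e : K) : set W :=
  [set y | forall k, `|f (i k) (y - x)| < e].

Definition weak_nbhs (x : W) : set_system W :=
  [set A | exists n (i : 'I_n -> I) e, 0 < e /\ weak_ball x i e `<=` A].

HB.instance Definition _ := hasNbhs.Build W weak_nbhs.

Lemma weak_ball_center (x : W) n (i : 'I_n -> I) e :
  0 < e -> weak_ball x i e x.
Proof. by move=> e0 k; rewrite subrr linear0 normr0. Qed.

Lemma weak_nbhs_filter (x : W) : ProperFilter (nbhs x).
Proof.
split.
  by move=> [n [i [e [e0]]]] /(_ x); apply; exact: weak_ball_center.
split.
- by exists 0%N, (fun k : 'I_0 => False_rect I (notF (ltn_ord k))), 1; split.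
- move=> A B [n [i [e [e0 iA]]]] [m [j [d [d0 jB]]]].
  have ed : (Num.min e d = e) \/ (Num.min e d = d).
    by rewrite minEle; case: ifP => _; [left|right].
  have cmp : e >=< d by apply: real_comparable; exact: gtr0_real.
  exists (n + m)%N, (fun k => match fintype.split k with inl a => i a | inr b => j b end).
  exists (Num.min e d); split; first by case: ed => ->.
  move=> y yk; split; [apply: iA => k|apply: jB => k].
    have := yk (unsplit (inl k)); rewrite unsplitK => /lt_le_trans; apply.
    by rewrite comparable_ge_min ?lexx.
  have := yk (unsplit (inr k)); rewrite unsplitK => /lt_le_trans; apply.
  by rewrite comparable_ge_min ?lexx ?orbT.
- move=> A B AB [n [i [e [e0 iA]]]]; exists n, i, e; split=> //.
  exact: subset_trans AB.
Qed.

Lemma weak_nbhs_singleton (x : W) (A : set W) : nbhs x A -> A x.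
Proof. by move=> [n [i [e [e0]]]]; apply; exact: weak_ball_center. Qed.

Lemma weak_ball_open (x y : W) n (i : 'I_n -> I) e :
  weak_ball x i e y -> weak_nbhs y (weak_ball x i e).
Proof.
move=> xy.
have [d d0 dP] : exists2 d : K, 0 < d &
    forall k, `|f (i k) (y - x)| + d <= e.
  elim: n i xy => [|n IHn] i xy; first by exists 1 => // -[].
  have [k|d d0 dP] := IHn (fun k => i (lift ord0 k)); first exact: xy.
  have e0 : 0 < e - `|f (i ord0) (y - x)| by rewrite subr_gt0.
  have cmp : d >=< e - `|f (i ord0) (y - x)|.
    by apply: real_comparable; exact: gtr0_real.
  exists (Num.min d (e - `|f (i ord0) (y - x)|)).
    by rewrite minEle; case: ifP.
  move=> k; rewrite -lerBrDl comparable_ge_min//.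
  case: (unliftP ord0 k) => [j ->|->]; last by rewrite lexx orbT.
  by rewrite lerBrDl dP.
exists n, i, d; split=> // z yz k.
have -> : z - x = (z - y) + (y - x) by rewrite addrA subrK.
rewrite linearD (le_lt_trans (ler_normD _ _))// addrC.
by rewrite (lt_le_trans _ (dP k))// ltrD2l; exact: yz.
Qed.

Lemma weak_nbhs_nbhs (x : W) (A : set W) : nbhs x A -> nbhs x (nbhs^~ A).
Proof.
move=> [n [i [e [e0 iA]]]]; exists n, i, e; split=> // y /weak_ball_open.
by move=> [m [j [d [d0 jB]]]]; exists m, j, d; split=> //; exact: subset_trans iA.
Qed.

HB.instance Definition _ := Nbhs_isNbhsTopological.Build W
  weak_nbhs_filter weak_nbhs_singleton weak_nbhs_nbhs.

Lemma weak_cvgP (F : set_system W) (x : W) : Filter F ->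
  F --> x <-> forall i, f i y @[y --> F] --> f i x.
Proof.
move=> FF; split=> [Fx i|Fx A [n [i [e [e0 iA]]]]].
  apply/cvgrPdist_lt => e e0; apply: Fx; exists 1%N, (fun=> i), e; split=> // y.
  by move=> /(_ ord0); rewrite linearB distrC.
apply: filterS iA _.
have : \forall y \near F, forall k : 'I_n, `|f (i k) (y - x)| < e.
  apply: filter_forall => k; have /cvgrPdist_lt/(_ e e0) := Fx (i k).
  by apply: filterS => y; rewrite linearB distrC.
by [].
Qed.

Lemma weak_functional_continuous i : continuous (f i : W -> K^o).
Proof.
move=> x; have /weak_cvgP/(_ i) : nbhs x --> (x : W) by exact: cvg_id.
by apply.
Qed.

Lemma weak_add_continuous : continuous (fun x : W * W => x.1 + x.2).
Proof.
move=> [x y]; apply/weak_cvgP => i /=; rewrite linearD.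
have fD : f i \o (fun z : W * W => z.1 + z.2) = (fun z => f i z.1 + f i z.2).
  by apply/funext => z /=; rewrite linearD.
change ((f i \o (fun z : W * W => z.1 + z.2)) @ nbhs (x, y) --> f i x + f i y).
rewrite fD; apply: cvgD.
  apply: (@cvg_comp _ _ _ fst (f i) _ (nbhs x)); first exact: cvg_fst.
  exact: weak_functional_continuous.
apply: (@cvg_comp _ _ _ snd (f i) _ (nbhs y)); first exact: cvg_snd.
exact: weak_functional_continuous.
Qed.

Lemma weak_scale_continuous : continuous (fun z : K^o * W => z.1 *: z.2).
Proof.
move=> [a x]; apply/weak_cvgP => i /=; rewrite linearZ.
have fZ : f i \o (fun z : K^o * W => z.1 *: z.2) = (fun z => z.1 *: f i z.2).
  by apply/funext => z /=; rewrite linearZ.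
change ((f i \o (fun z : K^o * W => z.1 *: z.2)) @ nbhs (a, x) --> a *: f i x).
rewrite fZ; apply: cvgZ; first exact: cvg_fst.
apply: (@cvg_comp _ _ _ snd (f i) _ (nbhs x)); first exact: cvg_snd.
exact: weak_functional_continuous.
Qed.

Lemma weak_locally_convex : exists2 B : set_system W,
  (forall b, b \in B -> convex_set b) & basis B.
Proof.
exists [set B | exists x n (i : 'I_n -> I) e, B = weak_ball x i e].
  move=> B; rewrite inE => -[x [n [i [e ->]]]]; apply/convex_setW => y z.
  rewrite !inE => yB zB l l0 l1; rewrite inE => k.
  pose t : K := l%:num.
  have E : t *: y + (1 - t) *: z - x = t *: (y - x) + (1 - t) *: (z - x).
    by rewrite !scalerBr addrACA -opprD -scalerDl [t + _]addrC subrK scale1r.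
  change (`|f (i k) ((t *: y + (1 - t) *: z : V) - x)| < e).
  have t1 : 0 < 1 - t by rewrite subr_gt0.
  rewrite E linearD !linearZ (le_lt_trans (ler_normD _ _))// !normrZ.
  rewrite (gtr0_norm l0) (gtr0_norm t1).
  have -> : e = t * e + (1 - t) * e.
    by rewrite -mulrDl [_ + (1 - _)]addrC subrK mul1r.
  by rewrite ltrD// ltr_pM2l//; [exact: yB|exact: zB].
split=> [B [x [n [i [e ->]]]]|x A [n [i [e [e0 iA]]]]].
  by rewrite openE => y; exact: weak_ball_open.
exists (weak_ball x i e) => //; split; first by exists x, n, i, e.
exact: weak_ball_center.
Qed.

HB.instance Definition _ := PreTopologicalLmod_isTvs.Build K W
  weak_add_continuous weak_scale_continuous weak_locally_convex.
(* The factory above only installs the uniform structure. *)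
HB.instance Definition _ :=
  PreTopologicalNmodule_isTopologicalNmodule.Build W weak_add_continuous.
HB.instance Definition _ :=
  TopologicalNmodule_isTopologicalLmodule.Build K W weak_scale_continuous.
HB.instance Definition _ := Uniform_isTvs.Build K W weak_locally_convex.

End weak_lcs_topology.

Definition weak_space (K : numFieldType) (E : tvsType K) : Type :=
  weak_lcs (fun chi : dual E => dual_fun chi : {linear E -> K^o}).

HB.instance Definition _ (K : numFieldType) (E : tvsType K) :=
  Tvs.on (weak_space E).

Definition weak_star (K : numFieldType) (E : tvsType K) : Type :=
  weak_lcs (fun x : E => dual_eval x : {linear dual E -> K^o}).

HB.instance Definition _ (K : numFieldType) (E : tvsType K) :=
  Tvs.on (weak_star E).

Lemma weak_space_cvgP (K : numFieldType) (E : tvsType K)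
    (F : set_system (weak_space E)) (x : weak_space E) : Filter F ->
  F --> x <-> forall chi : dual E, chi y @[y --> F] --> chi x.
Proof. exact: weak_cvgP. Qed.

Lemma weak_star_cvgP (K : numFieldType) (E : tvsType K)
    (F : set_system (weak_star E)) (chi : weak_star E) : Filter F ->
  F --> chi <->
  forall x : E, (psi : dual E) x @[psi --> F] --> (chi : dual E) x.
Proof. exact: weak_cvgP. Qed.

Definition strong_dual (K : numFieldType) (L : normedModType K) : Type := dual L.

Section strong_dual_norm.
Variables (R : realType) (s : scalars).
Local Notation K := (scalar_field R s).
Variable L : normedModType K.
Local Notation D := (strong_dual L).

HB.instance Definition _ := GRing.Lmodule.on D.

Definition op_norm (chi : D) : R :=
  sup [set modulus (chi x) | x in [set x : L | `|x| <= 1]].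

Lemma op_norm_has_sup (chi : D) :
  has_sup [set modulus (chi x) | x in [set x : L | `|x| <= 1]].
Proof.
split; first by exists (modulus (chi 0)), 0 => //=; rewrite normr0.
have /bounded_funP/(_ 1)[M chiM] :
    bounded_near (chi : {linear L -> K^o}) (nbhs (0 : L)).
  by apply/linear_bounded_continuous; exact: dual_continuous.
exists (modulus M) => _ [x x1 <-]; rewrite modulus_le.
have M0 : 0 <= M by rewrite (le_trans _ (chiM _ x1)).
by rewrite (ger0_norm M0); exact: chiM.
Qed.

Lemma op_norm_ub (chi : D) (x : L) : `|x| <= 1 -> modulus (chi x) <= op_norm chi.
Proof. by move=> x1; apply: ub_le_sup; [case: (op_norm_has_sup chi)|exists x]. Qed.

Lemma op_norm_le (chi : D) (M : R) :
  (forall x : L, `|x| <= 1 -> modulus (chi x) <= M) -> op_norm chi <= M.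
Proof.
move=> H; apply: ge_sup; first by case: (op_norm_has_sup chi).
by move=> _ [x x1 <-]; exact: H.
Qed.

Lemma op_norm_ge0 (chi : D) : 0 <= op_norm chi.
Proof.
by rewrite (le_trans (modulus_ge0 (chi 0)))// op_norm_ub ?normr0.
Qed.

Lemma op_normD (chi psi : D) : op_norm (chi + psi) <= op_norm chi + op_norm psi.
Proof.
apply: op_norm_le => x x1.
by rewrite (le_trans (modulusD _ _))// lerD// op_norm_ub.
Qed.

Lemma op_normZ_le (a : K) (chi : D) : op_norm (a *: chi) <= modulus a * op_norm chi.
Proof.
apply: op_norm_le => x x1.
by rewrite [leLHS]modulusM ler_wpM2l ?modulus_ge0// op_norm_ub.
Qed.

Lemma op_normZ (a : K) (chi : D) : op_norm (a *: chi) = modulus a * op_norm chi.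
Proof.
apply/eqP; rewrite eq_le op_normZ_le/=.
have [->|a0] := eqVneq a 0; first by rewrite modulus0 mul0r op_norm_ge0.
have := op_normZ_le a^-1 (a *: chi); rewrite scalerA mulVf// scale1r.
move=> /(ler_wpM2l (modulus_ge0 a))/le_trans; apply.
rewrite mulrA -modulusM divff// (_ : modulus 1 = 1) ?mul1r//.
by apply: (@of_real_inj R s); rewrite of_real_modulus normr1; case: (s).
Qed.

Lemma op_norm_eq0 (chi : D) : op_norm chi = 0 -> chi = 0.
Proof.
move=> chi0; apply: val_inj; apply/funext => x /=.
have [->|x0] := eqVneq x 0; first exact: linear0.
have nx0 : `|x| != 0 by rewrite normr_eq0.
have : modulus (chi (`|x|^-1 *: x)) <= 0.
  by rewrite -chi0 op_norm_ub// normrZ normfV normr_id mulVf.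
rewrite linearZ/= => m0.
have /modulus_eq0/eqP : modulus (`|x|^-1 *: chi x) = 0.
  by apply/eqP; rewrite eq_le m0 modulus_ge0.
by rewrite scaler_eq0 invr_eq0 (negbTE nx0) => /eqP.
Qed.

Definition strong_norm (chi : D) : K := of_real s (op_norm chi).

Lemma strong_normD (chi psi : D) :
  strong_norm (chi + psi) <= strong_norm chi + strong_norm psi.
Proof. by rewrite -of_realD ler_of_real op_normD. Qed.

Lemma strong_normZ (a : K) (chi : D) :
  strong_norm (a *: chi) = `|a| * strong_norm chi.
Proof. by rewrite /strong_norm op_normZ of_realM of_real_modulus. Qed.

Lemma strong_norm_eq0 (chi : D) : strong_norm chi = 0 -> chi = 0.
Proof. by rewrite -(of_real0 R s) => /of_real_inj/op_norm_eq0. Qed.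

HB.instance Definition _ := Lmodule_isNormed.Build K D
  strong_normD strong_normZ strong_norm_eq0.

End strong_dual_norm.

Section adjoint.
Variables (R : realType) (s : scalars).
Local Notation K := (scalar_field R s).
Variables (L : normedModType K) (E : tvsType K) (T : {linear L -> E}).
Hypothesis cT : continuous T.

Lemma adjoint_subproof (chi : weak_star E) :
  (fun x => (chi : dual E) (T x)) \in @linear_continuous K L.
Proof.
apply/linear_continuousP; split=> [a x y|x]; first by rewrite !linearP.
by apply: (@continuous_comp _ _ _ T); [exact: cT|exact: dual_continuous].
Qed.

Definition adjoint (chi : weak_star E) : strong_dual L :=
  Dual (adjoint_subproof chi).

Lemma adjoint_linear : linear adjoint.
Proof. by move=> a chi psi; apply: val_inj. Qed.

HB.instance Definition _ := GRing.isLinear.Build K (weak_star E) (strong_dual L)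
  _ adjoint adjoint_linear.

End adjoint.

(* Membership of a real sequence in ell_p, with c_0 in place of ell_oo. *)
Definition ell (R : realType) (p : \bar R) (u : nat -> R) : Prop :=
  match p with
  | r%:E => cvgn (series (fun n => `|u n| `^ r))
  | +oo%E => u @ \oo --> 0
  | -oo%E => False
  end.

Section summable_sequences.
Variables (R : realType) (s : scalars).
Local Notation K := (scalar_field R s).

Definition seminorm (G : tvsType K) (rho : G -> R) : Prop :=
  (forall x y, rho (x + y) <= rho x + rho y) /\
  (forall (a : K) x, rho (a *: x) = modulus a * rho x).

Definition weakly_summable (F : tvsType K) (p : \bar R) (x : nat -> F) : Prop :=
  forall chi : dual F, ell p (fun n => modulus (chi (x n))).

Definition strongly_summable (G : tvsType K) (q : \bar R) (y : nat -> G) : Prop :=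
  forall rho : G -> R, seminorm rho -> continuous rho ->
    ell q (fun n => rho (y n)).

Definition qp_convergent (F G : tvsType K) (q p : \bar R)
    (f : {linear F -> G}) : Prop :=
  forall x : nat -> F, weakly_summable p x -> strongly_summable q (f \o x).

Definition strictly_increasing (phi : nat -> nat) : Prop :=
  {homo phi : m n / (m < n)%N}.

Definition weakly_p_convergent (F : tvsType K) (p : \bar R) (x : nat -> F)
    (l : F) : Prop :=
  weakly_summable p (fun n => x n - l).

Definition weakly_p_cauchy (F : tvsType K) (p : \bar R) (x : nat -> F) : Prop :=
  forall k j : nat -> nat, strictly_increasing k -> strictly_increasing j ->
    weakly_summable p (fun n => x (k n) - x (j n)).

(* Not the library's [cauchy]: the uniform structure carried by a tvsType is
   not required to be the translation-invariant one. *)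
Definition cauchy_sequence (F : tvsType K) (x : nat -> F) : Prop :=
  forall U : set F, nbhs 0 U ->
    exists N, forall m n, (N <= m)%N -> (N <= n)%N -> U (x m - x n).

Definition has_subsequence (F : Type) (A : set F) (P : (nat -> F) -> Prop) : Prop :=
  forall x : nat -> F, (forall n, A (x n)) ->
    exists2 phi, strictly_increasing phi & P (x \o phi).

Definition rel_seq_compact (F : tvsType K) (A : set F) : Prop :=
  has_subsequence A (fun y => exists l : F, y @ \oo --> l).

Definition seq_precompact (F : tvsType K) (A : set F) : Prop :=
  has_subsequence A (@cauchy_sequence F).

Definition rel_weakly_seq_p_compact (F : tvsType K) (p : \bar R) (A : set F) :
    Prop :=
  has_subsequence A (fun y => exists l : F, weakly_p_convergent p y l).

Definition weakly_seq_p_precompact (F : tvsType K) (p : \bar R) (A : set F) :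
    Prop :=
  has_subsequence A (@weakly_p_cauchy F p).

End summable_sequences.

Variant compactness :=
  | WeaklySequentiallyCompact
  | SequentiallyCompact
  | WeaklySequentiallyPrecompact
  | SequentiallyPrecompact
  | WeaklySequentiallyPCompact
  | WeaklySequentiallyPPrecompact.

Section operators.
Variables (R : realType) (s : scalars).
Local Notation K := (scalar_field R s).

Definition subset_in_class (c : compactness) (p : \bar R) (E : tvsType K)
    (A : set E) : Prop :=
  match c with
  | WeaklySequentiallyCompact => rel_seq_compact (A : set (weak_space E))
  | SequentiallyCompact => rel_seq_compact A
  | WeaklySequentiallyPrecompact => seq_precompact (A : set (weak_space E))
  | SequentiallyPrecompact => seq_precompact A
  | WeaklySequentiallyPCompact => rel_weakly_seq_p_compact p A
  | WeaklySequentiallyPPrecompact => weakly_seq_p_precompact p A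
  end.

Definition operator_in_class (c : compactness) (p : \bar R) (L E : tvsType K)
    (T : L -> E) : Prop :=
  exists2 U : set L, nbhs 0 U & subset_in_class c p (T @` U).

(* The explicit upper bounds exclude infinite suprema, for which the library's
   real-valued [sup] is 0. *)
Definition limited (p q : \bar R) (E : tvsType K) (A : set E) : Prop :=
  A !=set0 /\
  forall chi : nat -> weak_star E, weakly_summable p chi ->
    (forall n, has_ubound [set modulus ((chi n : dual E) a) | a in A]) /\
    ell q (fun n => sup [set modulus ((chi n : dual E) a) | a in A]).

Definition absolutely_convex (E : tvsType K) (A : set E) : Prop :=
  forall (a b : K) x y, A x -> A y -> `|a| + `|b| <= 1 -> A (a *: x + b *: y).

Definition locally_complete (E : tvsType K) : Prop :=
  forall x : nat -> E, x @ \oo --> 0 ->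
    compact (closure (smallest (@absolutely_convex E) (range x))).

Definition adjoint_convergent_in_class (c : compactness) (p q : \bar R)
    (L : normedModType K) (E : tvsType K) : Prop :=
  forall (T : {linear L -> E}) (cT : continuous T),
    qp_convergent q p (adjoint cT) -> operator_in_class c p T.

End operators.

Section l1_space.
Variables (R : realType) (s : scalars).
Local Notation K := (scalar_field R s).

Definition absolutely_summable : {pred (nat -> K^o)} :=
  [pred u : nat -> K^o | `[< ell 1%:E (fun n => modulus (u n)) >]].

Record l1 := L1 {
  l1_seq :> nat -> K^o ;
  _ : l1_seq \in absolutely_summable }.

HB.instance Definition _ := [isSub for l1_seq].
HB.instance Definition _ := [Choice of l1 by <:].

Lemma absolutely_summableP (u : nat -> K^o) :
  reflect (cvgn (series (fun n => modulus (u n)))) (u \in absolutely_summable).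
Proof.
have E : (fun n => `|modulus (u n)| `^ 1) = (fun n => modulus (u n)).
  by apply/funext => n; rewrite powRr1 ger0_norm// modulus_ge0.
by apply: (iffP (asboolP _)); rewrite /ell E.
Qed.

Lemma series_modulusD (u v : nat -> K^o) n :
  series (fun n => modulus (u n + v n)) n <=
  series (fun n => modulus (u n)) n + series (fun n => modulus (v n)) n.
Proof.
by rewrite !seriesEnat/= -big_split/= ler_sum// => k _; exact: modulusD.
Qed.

Lemma series_modulusZ (a : K) (u : nat -> K^o) :
  series (fun n => modulus (a * u n)) =
  modulus a \*: series (fun n => modulus (u n)).
Proof.
apply/funext => n; rewrite !seriesEnat/= scaler_sumr.
by apply: eq_bigr => k _; rewrite modulusM.
Qed.

Lemma series_modulus_nondecreasing (u : nat -> K^o) :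
  nondecreasing_seq (series (fun n => modulus (u n))).
Proof. by apply: nondecreasing_series => n _ _; exact: modulus_ge0. Qed.

Lemma absolutely_summable_submod_closed : submod_closed absolutely_summable.
Proof.
split.
  apply/absolutely_summableP.
  have -> : series (fun n => modulus ((0 : nat -> K^o) n)) = fun=> 0 :> R.
    by apply/funext => n; rewrite seriesEnat/= big1// => k _; exact: modulus0.
  exact: is_cvg_cst.
move=> a u v /absolutely_summableP cu /absolutely_summableP cv.
apply/absolutely_summableP.
pose au n : K^o := a * u n.
have cau : cvgn (series (fun n => modulus (au n))).
  by rewrite series_modulusZ; exact: is_cvgZl_tmp.
apply: nondecreasing_is_cvgn; first exact: series_modulus_nondecreasing.
exists (limn (series (fun n => modulus (au n))) +
        limn (series (fun n => modulus (v n)))) => _ [n _ <-].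
rewrite (le_trans (series_modulusD au v n))// lerD//.
  exact: nondecreasing_cvgn_le (series_modulus_nondecreasing _) cau n.
exact: nondecreasing_cvgn_le (series_modulus_nondecreasing _) cv n.
Qed.

HB.instance Definition _ := GRing.isSubmodClosed.Build K (nat -> K^o)
  absolutely_summable absolutely_summable_submod_closed.
HB.instance Definition _ := [SubChoice_isSubLmodule of l1 by <:].

Lemma l1_cvg (u : l1) : cvgn (series (fun n => modulus (u n))).
Proof. by case: u => u /= /absolutely_summableP. Qed.

Definition l1_sum (u : l1) : R := limn (series (fun n => modulus (u n))).

Lemma l1_sum_ub (u : l1) n : series (fun n => modulus (u n)) n <= l1_sum u.
Proof.
apply: nondecreasing_cvgn_le; last exact: l1_cvg.
exact: series_modulus_nondecreasing.
Qed.

Definition l1_norm (u : l1) : K := of_real s (l1_sum u).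

Lemma l1_normD (u v : l1) : l1_norm (u + v) <= l1_norm u + l1_norm v.
Proof.
rewrite -of_realD ler_of_real; apply: limr_le; first exact: l1_cvg.
near=> n; rewrite (le_trans (series_modulusD u v n))// lerD ?l1_sum_ub.
Unshelve. all: by end_near. Qed.

Lemma l1_normZ (a : K) (u : l1) : l1_norm (a *: u) = `|a| * l1_norm u.
Proof.
rewrite /l1_norm -of_real_modulus -of_realM; congr of_real.
transitivity (limn (series (fun n => modulus (a * u n)))); first by [].
by rewrite series_modulusZ limZl_tmp//; exact: l1_cvg.
Qed.

Lemma l1_norm_eq0 (u : l1) : l1_norm u = 0 -> u = 0.
Proof.
rewrite -(of_real0 R s) => /of_real_inj u0; apply: val_inj; apply/funext => n.
apply: modulus_eq0; apply/eqP; rewrite eq_le modulus_ge0 andbT -u0.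
apply: le_trans (l1_sum_ub u n.+1).
rewrite seriesEnat/= big_nat_recr//= lerDr sumr_ge0// => k _.
exact: modulus_ge0.
Qed.

HB.instance Definition _ := Lmodule_isNormed.Build K l1
  l1_normD l1_normZ l1_norm_eq0.

Lemma unit_vector_subproof (i : nat) :
  (fun n => (n == i)%:R : K^o) \in absolutely_summable.
Proof.
apply/absolutely_summableP; apply: nondecreasing_is_cvgn.
  exact: series_modulus_nondecreasing.
exists (modulus (1 : K)) => _ [n _ <-]; rewrite seriesEnat/= big_mkord.
have [ni|ni] := leqP n i.
  rewrite big1 ?modulus_ge0// => k _.
  by rewrite (ltn_eqF (leq_trans (ltn_ord k) ni)) modulus0.
rewrite (bigD1 (Ordinal ni))//= eqxx big1 ?addr0// => k.
by rewrite -val_eqE/= => /negbTE ->; exact: modulus0.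
Qed.

Definition unit_vector (i : nat) : l1 := L1 (unit_vector_subproof i).

Definition unit_vector_span : {pred l1} :=
  [pred u : l1 | `[< exists n (c : nat -> K),
    u = \sum_(i < n) c i *: unit_vector i >]].

Record l1_0 := L1_0 {
  l1_0_val :> l1 ;
  _ : l1_0_val \in unit_vector_span }.

HB.instance Definition _ := [isSub for l1_0_val].
HB.instance Definition _ := [Choice of l1_0 by <:].

Lemma unit_vector_span_submod_closed : submod_closed unit_vector_span.
Proof.
split; first by apply/asboolP; exists 0%N, (fun=> 0); rewrite big_ord0.
move=> a u v /asboolP[n [c ->]] /asboolP[m [d ->]]; apply/asboolP.
have widen k (b : nat -> K) : (k <= n + m)%N ->
    \sum_(i < k) b i *: unit_vector i =
    \sum_(i < n + m) (if (i < k)%N then b i else 0) *: unit_vector i.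
  move=> knm; rewrite (big_ord_widen _ (fun i => b i *: unit_vector i) knm).
  by rewrite big_mkcond; apply: eq_bigr => i _; case: ifP => // _; rewrite scale0r.
exists (n + m)%N, (fun i =>
  a * (if (i < n)%N then c i else 0) + (if (i < m)%N then d i else 0)).
rewrite (widen n) ?leq_addr// (widen m) ?leq_addl// scaler_sumr -big_split.
by apply: eq_bigr => i _; rewrite /= scalerA -scalerDl.
Qed.

HB.instance Definition _ := GRing.isSubmodClosed.Build K l1
  unit_vector_span unit_vector_span_submod_closed.
HB.instance Definition _ := [SubChoice_isSubLmodule of l1_0 by <:].

Definition l1_0_norm (u : l1_0) : K := `|u : l1|.

Lemma l1_0_normD (u v : l1_0) : l1_0_norm (u + v) <= l1_0_norm u + l1_0_norm v.
Proof. exact: ler_normD. Qed.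

Lemma l1_0_normZ (a : K) (u : l1_0) : l1_0_norm (a *: u) = `|a| * l1_0_norm u.
Proof. exact: normrZ. Qed.

Lemma l1_0_norm_eq0 (u : l1_0) : l1_0_norm u = 0 -> u = 0.
Proof. by move=> /normr0_eq0 u0; exact: val_inj. Qed.

HB.instance Definition _ := Lmodule_isNormed.Build K l1_0
  l1_0_normD l1_0_normZ l1_0_norm_eq0.

End l1_space.

(* Main.v *)
Require Import Defs.
From HB Require Import structures.
From mathcomp Require Import all_boot all_order all_algebra.
From mathcomp Require Import all_classical all_reals all_analysis.
From mathcomp Require Import complex ring lra.

Import Order.TTheory GRing.Theory Num.Theory.
Import numFieldNormedType.Exports.

Set Implicit Arguments.
Unset Strict Implicit.
Unset Printing Implicit Defensive.

Local Open Scope classical_set_scope.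
Local Open Scope ring_scope.

(** An operator [T] from a normed space has a [(q,p)]-convergent adjoint exactly
    when [T] maps the unit ball to a [(p,q)]-limited set: the norm of the adjoint at
    [chi] is the supremum of [chi] over that image. So if limited sets are compact
    (in any of the six senses), then such a [T] is compact
    ([adjoint_convergent_in_class_of_limited]).

    Conversely, compactness of a limited set [A] is tested on its sequences. A
    sequence [x] in [A] is the image of the unit vectors under the synthesis
    operator [u |-> sum of the u k *: x k] ([synthesis_operator]). On finitely
    supported [u] the sum is finite; the norm of the adjoint at [chi] is at most
    the supremum of [chi] over [A], so the hypothesis applies to this operator, and
    the image of a ball contains a dilate of the sequence
    ([subset_in_class_of_synthesis]).

    The operator is continuous because [A] is bounded. The definition of a limited
    set only gives weak boundedness, and boundedness follows by Mackey's theorem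
    ([weakly_bounded_seminorm_bounded]). For it, real functionals norming given
    points come from the Hahn-Banach theorem, here deduced from the existence of
    minimal sublinear functionals ([real_hahn_banach]); a gliding hump sums them
    into a single real functional ([hump_limit]); and a real functional is extended
    to the scalars only at the end ([real_linear_scalar_extension]).

    For [l1] the series has to converge, which is where local completeness enters.
    With [r k] the tails of the sum of the [modulus (u k)], and up to a constant,
    [u k *: x k] equals [(u k / sqrt (r k)) *: (sqrt (r k) *: x k)], where the first
    factors are still summable and the second form a null sequence. The partial
    sums then form a Cauchy sequence in the compact closed absolutely convex hull
    of a null sequence, hence converge ([locally_complete_l1_series]). *)

(** * Scalars, seminorms and neighbourhoods of zero *)

Section modulus_extra.
Variables (R : realType) (s : scalars).
Local Notation K := (scalar_field R s).
Implicit Types (a b : K) (x y : R).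

Lemma of_real1 : of_real s (1 : R) = 1.
Proof. by case: s => //=; rewrite rmorph1. Qed.

Lemma of_realN x : of_real s (- x) = - of_real s x.
Proof. by case: s => //=; rewrite rmorphN. Qed.

Lemma of_realV x : of_real s x^-1 = (of_real s x)^-1.
Proof. by case: s => //=; rewrite fmorphV. Qed.

Lemma of_real_eq0 x : (of_real s x == 0) = (x == 0).
Proof. by rewrite -(of_real0 R s) (inj_eq (@of_real_inj R s)). Qed.

Lemma ltr_of_real x y : (of_real s x < of_real s y) = (x < y).
Proof. by rewrite !lt_neqAle ler_of_real (inj_eq (@of_real_inj R s)). Qed.

Lemma normr_of_real x : `|of_real s x| = of_real s `|x|.
Proof.
have [x0|/ltW x0] := leP 0 x.
  by rewrite !ger0_norm// -(of_real0 R s) ler_of_real.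
by rewrite !ler0_norm ?of_realN// -(of_real0 R s) ler_of_real.
Qed.

Lemma modulus_of_real x : modulus (of_real s x) = `|x|.
Proof. by apply: (@of_real_inj R s); rewrite of_real_modulus normr_of_real. Qed.

Lemma modulus1 : modulus (1 : K) = 1.
Proof. by rewrite -of_real1 modulus_of_real normr1. Qed.

Lemma modulusN a : modulus (- a) = modulus a.
Proof. by apply: (@of_real_inj R s); rewrite !of_real_modulus normrN. Qed.

Lemma modulusV a : modulus a^-1 = (modulus a)^-1.
Proof.
by apply: (@of_real_inj R s); rewrite of_realV !of_real_modulus normfV.
Qed.

Lemma modulus_norm a : modulus `|a| = modulus a.
Proof. by apply: (@of_real_inj R s); rewrite !of_real_modulus normr_id. Qed.

Lemma modulus_gt0 a : (0 < modulus a) = (a != 0).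
Proof.
rewrite lt_neqAle modulus_ge0 andbT eq_sym; congr (~~ _).
by apply/eqP/eqP => [/modulus_eq0//|->]; exact: modulus0.
Qed.

Lemma pos_of_real a : 0 < a -> of_real s (modulus a) = a.
Proof. by move=> a0; rewrite of_real_modulus gtr0_norm. Qed.

End modulus_extra.

Section tvs_extra.
Variables (K : numFieldType) (E : tvsType K).

Lemma cvgD_tvs (T : Type) (F : set_system T) {FF : Filter F} (f g : T -> E) (a b : E) :
  f @ F --> a -> g @ F --> b -> (fun x => f x + g x) @ F --> a + b.
Proof.
move=> fa gb.
apply: (@cvg_comp _ _ _ (fun x => (f x, g x)) (fun z : E * E => z.1 + z.2) F
  (nbhs (a, b))); last exact: (@add_continuous E (a, b)).
exact: (cvg_pair fa gb).
Qed.

Lemma cvgZ_tvs (T : Type) (F : set_system T) {FF : Filter F} (k : T -> K^o) (f : T -> E)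
    (c : K^o) (a : E) :
  k @ F --> c -> f @ F --> a -> (fun x => k x *: f x) @ F --> c *: a.
Proof.
move=> kc fa.
apply: (@cvg_comp _ _ _ (fun x => (k x, f x)) (fun z : K^o * E => z.1 *: z.2) F
  (nbhs (c, a))); last exact: (@scale_continuous K E (c, a)).
exact: (cvg_pair kc fa).
Qed.

Lemma cvgB_tvs (T : Type) (F : set_system T) {FF : Filter F} (f g : T -> E) (a b : E) :
  f @ F --> a -> g @ F --> b -> (fun x => f x - g x) @ F --> a - b.
Proof.
move=> fa gb; apply: (cvgD_tvs fa).
exact: (@cvg_comp _ _ _ g (-%R) F (nbhs b) _ gb (@opp_continuous E b)).
Qed.

Lemma nbhs0_scale (U : set E) (c : K) : c != 0 ->
  nbhs 0 U -> nbhs 0 [set x | U (c *: x)].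
Proof.
move=> c0 U0.
have : (fun x : E => c *: x) @ (0 : E) --> c *: (0 : E).
  by apply: (cvgZ_tvs (k := fun=> c) (f := id)); [exact: cvg_cst|exact: cvg_id].
by rewrite scaler0; exact.
Qed.

Lemma nbhs_translate (U : set E) (x : E) :
  nbhs 0 U -> nbhs x [set y | U (y - x)].
Proof.
move=> U0.
have : (fun y : E => y - x) @ x --> x - x.
  by apply: cvgB_tvs; [exact: cvg_id|exact: cvg_cst].
by rewrite subrr; exact.
Qed.

Lemma nbhs_translate_inv (U : set E) (x : E) :
  nbhs x U -> nbhs 0 [set y | U (x + y)].
Proof.
move=> Ux.
have : (fun y : E => x + y) @ (0 : E) --> x + 0.
  by apply: cvgD_tvs; [exact: cvg_cst|exact: cvg_id].
by rewrite addr0; exact.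
Qed.

End tvs_extra.

Section seminorms.
Variables (R : realType) (s : scalars).
Local Notation K := (scalar_field R s).
Variable E : tvsType K.
Implicit Types (rho : E -> R) (x y : E).

Lemma seminorm0 rho : seminorm rho -> rho 0 = 0.
Proof. by move=> [_ h]; rewrite -(scale0r (0 : E)) h modulus0 mul0r. Qed.

Lemma seminormN rho x : seminorm rho -> rho (- x) = rho x.
Proof. by move=> [_ h]; rewrite -scaleN1r h modulusN modulus1 mul1r. Qed.

Lemma seminormB rho x y : seminorm rho -> rho (x - y) <= rho x + rho y.
Proof. by move=> h; rewrite -(seminormN y h); apply: h.1. Qed.

Lemma seminorm_distC rho x y : seminorm rho -> rho (x - y) = rho (y - x).
Proof. by move=> h; rewrite -(seminormN _ h) opprB. Qed.

Lemma seminorm_ge0 rho x : seminorm rho -> 0 <= rho x.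
Proof.
move=> h; have := seminormB x x h; rewrite subrr seminorm0//.
by rewrite -mulr2n pmulrn_lge0.
Qed.

Lemma seminorm_sum rho n (f : nat -> E) : seminorm rho ->
  rho (\sum_(k < n) f k) <= \sum_(k < n) rho (f k).
Proof.
move=> h; elim: n => [|n IH]; first by rewrite !big_ord0 seminorm0.
by rewrite !big_ord_recr/= (le_trans (h.1 _ _))// lerD2r.
Qed.

Lemma seminorm_nbhs0 rho (e : R) :
  seminorm rho -> continuous rho -> 0 < e -> nbhs 0 [set x | rho x < e].
Proof.
move=> h c e0; have /= := c 0 [set r | r < e]; rewrite seminorm0//; apply.
exact: lt_nbhsl.
Qed.

(** A seminorm is Lipschitz for itself, so continuity at one point, on one
    ball, already gives continuity everywhere. *)
Lemma seminorm_continuous rho :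
  seminorm rho -> nbhs 0 [set x | rho x < 1] -> continuous rho.
Proof.
move=> h n0 x; apply/cvgrPdist_lt => e e0.
have e0' : (of_real s e)^-1 != 0 by rewrite invr_eq0 of_real_eq0 gt_eqF.
apply: filterS (nbhs_translate x (nbhs0_scale e0' n0)) => y /=.
rewrite h.2 modulusV modulus_of_real gtr0_norm// mulrC ltr_pdivrMr// mul1r.
apply: le_lt_trans; rewrite ler_norml.
have yx := h.1 (y - x) x; have xy := h.1 (x - y) y; rewrite !subrK in yx xy.
by rewrite (seminorm_distC _ _ h) in xy; apply/andP; split; lra.
Qed.

Lemma seminorm_dual (chi : dual E) : seminorm (fun x => modulus (chi x)).
Proof.
split=> [x y|a x]; first by rewrite linearD modulusD.
by rewrite linearZ/= -modulusM.
Qed.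

Lemma dual_seminorm_continuous (chi : dual E) :
  continuous (fun x => modulus (chi x)).
Proof.
apply: seminorm_continuous; first exact: seminorm_dual.
have : chi x @[x --> (0 : E)] --> chi 0 by exact: dual_continuous.
rewrite linear0 => /cvgrPdist_lt/(_ 1 ltr01).
apply: filterS => x /=; rewrite sub0r normrN -of_real_modulus -of_real1.
by rewrite ltr_of_real.
Qed.

Definition gauge (W : set E) x : R :=
  inf [set t | 0 < t /\ W ((of_real s t)^-1 *: x)].

Section gauge_theory.
Variable W : set E.
Hypotheses (acW : absolutely_convex W) (nW : nbhs 0 W).

Lemma absorbing x : exists2 t : R, 0 < t & W ((of_real s t)^-1 *: x).
Proof.
have : (fun a : K^o => a *: x) @ (0 : K^o) --> (0 : K^o) *: x.
  by apply: (cvgZ_tvs (FF := nbhs_filter (0 : K^o)) (k := id) (f := fun=> x)); [exact: cvg_id|exact: cvg_cst].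
rewrite scale0r => /(_ _ nW) [e/= e0 eW].
exists (2 / modulus e).
  by rewrite divr_gt0// modulus_gt0 gt_eqF.
apply: eW; rewrite /= sub0r normrN -of_realV normr_of_real invf_div.
have m0 : 0 < modulus e by rewrite modulus_gt0 gt_eqF.
rewrite ger0_norm ?divr_ge0 ?ltW//= -[ltRHS](pos_of_real e0) ltr_of_real.
by rewrite ltr_pdivrMr// ltr_pMr// ltr1n.
Qed.

Lemma gauge_has_inf x : has_inf [set t | 0 < t /\ W ((of_real s t)^-1 *: x)].
Proof.
split; first by have [t t0 tW] := absorbing x; exists t.
by exists 0 => t [/ltW].
Qed.

Lemma gauge_le x t : 0 < t -> W ((of_real s t)^-1 *: x) -> gauge W x <= t.
Proof. by move=> t0 tW; apply: ge_inf => //; have [] := gauge_has_inf x. Qed.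

Lemma le_gauge x m : (forall t, 0 < t -> W ((of_real s t)^-1 *: x) -> m <= t) ->
  m <= gauge W x.
Proof.
by move=> h; apply: lb_le_inf; [have [] := gauge_has_inf x|move=> t [? ?]; exact: h].
Qed.

Lemma gauge_ge0 x : 0 <= gauge W x.
Proof. by apply: le_gauge => t /ltW. Qed.

Lemma balanced a x : `|a| <= 1 -> W x -> W (a *: x).
Proof.
move=> a1 Wx; have := acW (a := a) (b := 0) Wx Wx.
by rewrite scale0r addr0 normr0 addr0; exact.
Qed.

Lemma gaugeZ_le a x : gauge W (a *: x) <= modulus a * gauge W x.
Proof.
have [->|a0] := eqVneq a 0.
  rewrite modulus0 mul0r scale0r leNgt; apply/negP => g0.
  have : gauge W 0 <= gauge W 0 / 2.
    apply: gauge_le; first by rewrite divr_gt0.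
    by rewrite scaler0; exact: nbhs_singleton.
  by apply/negP; rewrite -ltNge ltr_pdivrMr// ltr_pMr// ltr1n.
have ma : 0 < modulus a by rewrite modulus_gt0.
rewrite mulrC -ler_pdivrMr//; apply: le_gauge => t t0 tW.
rewrite ler_pdivrMr//; apply: gauge_le; first exact: mulr_gt0.
rewrite scalerA of_realM.
have : W ((a / of_real s (modulus a)) *: ((of_real s t)^-1 *: x)).
  apply: balanced => //.
  by rewrite normrM normfV normr_of_real (ger0_norm (modulus_ge0 a)) of_real_modulus divff
    ?normr_eq0.
rewrite scalerA; set u := (X in W (X *: x) -> _).
set v := (X in _ -> W (X *: x)); have -> : v = u; last by [].
by rewrite /u /v invfM mulrAC -mulrA mulrC.
Qed.

Lemma gauge_seminorm : seminorm (gauge W).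
Proof.
split=> [x y|a x].
  rewrite -lerBlDr; apply: le_gauge => t t0 tW; rewrite lerBlDr -lerBlDl.
  apply: le_gauge => r r0 rW; rewrite lerBlDl; apply: gauge_le.
    exact: addr_gt0.
  have t0' : of_real s t != 0 by rewrite of_real_eq0 gt_eqF.
  have r0' : of_real s r != 0 by rewrite of_real_eq0 gt_eqF.
  have tr0 : of_real s t + of_real s r != 0.
    by rewrite -of_realD of_real_eq0 gt_eqF// addr_gt0.
  have := acW (a := of_real s (t / (t + r))) (b := of_real s (r / (t + r))) tW rW.
  rewrite !scalerA scalerDr !of_realM !of_realV of_realD => h.
  have -> : (of_real s t + of_real s r)^-1 *: x =
      (of_real s t / (of_real s t + of_real s r) / of_real s t) *: x.
    by rewrite mulrAC divff// mul1r.
  have -> : (of_real s t + of_real s r)^-1 *: y =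
      (of_real s r / (of_real s t + of_real s r) / of_real s r) *: y.
    by rewrite mulrAC divff// mul1r.
  apply: h; rewrite -!of_realD -!of_realV -!of_realM !normr_of_real -of_realD.
  rewrite -of_real1 ler_of_real.
  rewrite !ger0_norm ?divr_ge0 ?addr_ge0 ?(ltW t0) ?(ltW r0)//.
  by rewrite -mulrDl divff// gt_eqF// addr_gt0.
apply/eqP; rewrite eq_le gaugeZ_le/=.
have [->|a0] := eqVneq a 0; first by rewrite modulus0 mul0r gauge_ge0.
have := gaugeZ_le a^-1 (a *: x); rewrite scalerA mulVf// scale1r modulusV mulrC.
have ma : 0 < modulus a by rewrite modulus_gt0.
by rewrite ler_pdivlMr// mulrC.
Qed.

Lemma gauge_lt1 x : gauge W x < 1 -> W x.
Proof.
move=> /(inf_lt (gauge_has_inf x).1)[t [t0 tW] t1].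
have t0' : of_real s t != 0 by rewrite of_real_eq0 gt_eqF.
rewrite -[x]scale1r -(divff t0') -scalerA; apply: balanced => //.
by rewrite normr_of_real -of_real1 ler_of_real gtr0_norm// ltW.
Qed.

Lemma gauge_continuous : continuous (gauge W).
Proof.
apply: seminorm_continuous; first exact: gauge_seminorm.
have c0 : of_real s (2 : R) != 0 by rewrite of_real_eq0.
apply: filterS (nbhs0_scale c0 nW) => x /= Wx.
apply: (@le_lt_trans _ _ (2^-1)); last by rewrite invf_lt1// ltr1n.
by apply: gauge_le => //; rewrite of_realV invrK.
Qed.

End gauge_theory.

(** A convex neighbourhood is balanced by keeping the points all of whose
    multiples by scalars of modulus at most 1 stay inside; joint continuity of
    the scaling at zero leaves a neighbourhood. *)
Lemma absolutely_convex_nbhs (U : set E) : nbhs 0 U ->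
  exists W : set E, [/\ absolutely_convex W, nbhs 0 W & W `<=` U].
Proof.
move=> U0; have [B cB [oB bB]] := @locally_convex K E.
have [V [BV V0] VU] := bB 0 _ U0.
have {cB} cV : forall t x y, 0 <= t -> t <= 1 -> V x -> V y ->
    V (of_real s t *: x + (1 - of_real s t) *: y).
  move=> t x y t0 t1 Vx Vy.
  have t0' : 0 <= of_real s t by rewrite -(of_real0 R s) ler_of_real.
  have t1' : of_real s t <= 1 by rewrite -of_real1 ler_of_real.
  have/set_mem := cB V (mem_set BV) x y (Itv01 t0' t1') (mem_set Vx) (mem_set Vy).
  by [].
exists [set x | forall a : K, `|a| <= 1 -> V (a *: x)]; split.
- move=> a b x y Vx Vy ab c c1.
  have ab' : modulus a + modulus b <= 1.
    by rewrite -(ler_of_real s) of_realD !of_real_modulus of_real1.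
  pose t := modulus a.
  have t1 : t <= 1 by rewrite (le_trans _ ab')// lerDl modulus_ge0.
  (* A null divisor is harmless: it forces the dividend to be null. *)
  have Z (d : K) (r : R) : modulus d <= r -> `|c * d / of_real s r| <= 1 /\
      of_real s r * (c * d / of_real s r) = c * d.
    move=> dr; have [r0|r0] := eqVneq r 0.
      have -> : d = 0.
        by apply: modulus_eq0; apply/eqP; rewrite eq_le modulus_ge0 -r0 dr.
      by rewrite r0 of_real0 !mulr0 !mul0r normr0 ler01.
    have r1 : 0 < r by rewrite lt_neqAle eq_sym r0 (le_trans (modulus_ge0 d)).
    split; last by rewrite mulrC divfK// of_real_eq0.
    rewrite normrM normfV normr_of_real (gtr0_norm r1) ler_pdivrMr; last first.
      by rewrite -(of_real0 R s) ltr_of_real.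
    by rewrite mul1r normrM -[leRHS]mul1r ler_pM// -of_real_modulus ler_of_real.
  have [u1 uE] := Z a t (lexx _).
  have bt : modulus b <= 1 - t by rewrite lerBrDl.
  have [v1 vE] := Z b (1 - t) bt.
  have := cV t _ _ (modulus_ge0 a) t1 (Vx _ u1) (Vy _ v1).
  rewrite !scalerA uE -of_real1 -of_realN -of_realD vE.
  by rewrite -!scalerA -scalerDr.
- have sc : (fun z : K^o * E => z.1 *: z.2) @ ((0 : K^o), (0 : E)) --> (0 : E).
    by have := @scale_continuous K E (0, 0); rewrite /continuous_at/= scale0r.
  have [[N M] /= [[e/= e0 eN] M0] NM] := sc V (open_nbhs_nbhs (conj (oB _ BV) V0)).
  have h0 : e / 2 != 0 by rewrite mulf_neq0// ?invr_eq0 ?gt_eqF.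
  apply: filterS (nbhs0_scale (c := (e / 2)^-1) _ M0); last by rewrite invr_eq0.
  move=> x /= Mx a a1.
  have := NM (a * (e / 2), (e / 2)^-1 *: x); rewrite /= scalerA mulfK//; apply.
  split => //; apply: eN; rewrite /= sub0r normrN normrM.
  have e2 : 0 < e / 2 by rewrite divr_gt0.
  rewrite (gtr0_norm e2) (@le_lt_trans _ _ (e / 2))//.
    by rewrite ler_piMl// ltW.
  by rewrite ltr_pdivrMr// ltr_pMr// ltr1n.
- by move=> x /(_ 1); rewrite normr1 lexx scale1r => /(_ isT)/VU.
Qed.

(** Open unit balls of continuous seminorms form a base at zero, so that
    topological statements about [E] become inequalities between real numbers. *)
Lemma nbhs0_seminorm (U : set E) : nbhs 0 U ->
  exists rho, [/\ seminorm rho, continuous rho & [set x | rho x < 1] `<=` U].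
Proof.
move=> /absolutely_convex_nbhs[W [aW nW WU]]; exists (gauge W); split.
- exact: gauge_seminorm.
- exact: gauge_continuous.
- by move=> x /= /gauge_lt1 Wx; apply: WU; exact: Wx.
Qed.

Lemma seminorm_cvg (T : Type) (F : set_system T) {FF : Filter F} (f : T -> E)
    (l : E) :
  (forall rho, seminorm rho -> continuous rho -> \forall x \near F, rho (f x - l) < 1) ->
  f @ F --> l.
Proof.
move=> h A /nbhs_translate_inv/nbhs0_seminorm[rho [srho crho rhoA]].
apply: filterS (h _ srho crho) => x /= /rhoA /=.
by rewrite addrC subrK.
Qed.

End seminorms.

(** * The Hahn-Banach theorem *)

Section hahn_banach.
Variables (R : realType) (s : scalars).
Local Notation K := (scalar_field R s).
Variable E : lmodType K.
Implicit Types (f : E -> R) (x y : E).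

Definition sublinear f : Prop :=
  (forall x y, f (x + y) <= f x + f y) /\
  (forall (t : R) x, 0 <= t -> f (of_real s t *: x) = t * f x).

Definition real_linear f : Prop :=
  forall (t : R) x y, f (of_real s t *: x + y) = t * f x + f y.

Lemma real_linear0 f : real_linear f -> f 0 = 0.
Proof. by move=> lf; have := lf 1 0 0; rewrite scaler0 addr0 mul1r; lra. Qed.

Lemma real_linearN f x : real_linear f -> f (- x) = - f x.
Proof.
move=> lf; have := lf (-1) x 0.
by rewrite of_realN of_real1 scaleN1r addr0 (real_linear0 lf) addr0 mulN1r.
Qed.

Lemma sublinear0 f : sublinear f -> f 0 = 0.
Proof. by move=> [_ h]; rewrite -(scale0r (0 : E)) -(of_real0 R s) h// mul0r. Qed.

Lemma sublinear_ge f x : sublinear f -> - f (- x) <= f x.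
Proof.
by move=> h; rewrite lerNl -subr_ge0 opprK -(sublinear0 h) -(addNr x) h.1.
Qed.

Lemma sublinear_from_le f : f 0 = 0 -> (forall x y, f (x + y) <= f x + f y) ->
  (forall (t : R) x, 0 < t -> f (of_real s t *: x) <= t * f x) -> sublinear f.
Proof.
move=> f0 fD fZ; split => // t x; rewrite le_eqVlt => /predU1P[<-|t0].
  by rewrite of_real0 scale0r f0 mul0r.
apply/eqP; rewrite eq_le fZ//=.
have := fZ t^-1 (of_real s t *: x); rewrite invr_gt0 => /(_ t0).
rewrite scalerA of_realV mulVf ?scale1r ?of_real_eq0 ?gt_eqF//.
by rewrite mulrC ler_pdivlMr// mulrC.
Qed.

(** The largest sublinear minorant [g] of [f] with [g (x + t y) = g x + t f y] for
    all [t >= 0]. *)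
Definition flatten_along f y x : R :=
  inf [set f (x + of_real s t *: y) - t * f y | t in [set t | 0 <= t]].

Section flatten_along_theory.
Variables (f : E -> R) (y : E).
Hypothesis sf : sublinear f.

Lemma flatten_along_lbound x t : 0 <= t ->
  - f (- x) <= f (x + of_real s t *: y) - t * f y.
Proof.
move=> t0; rewrite lerBrDl -sf.2// lerBlDr addrC.
by have := sf.1 (x + of_real s t *: y) (- x); rewrite addrAC subrr add0r addrC.
Qed.

Lemma flatten_along_has_inf x :
  has_inf [set f (x + of_real s t *: y) - t * f y | t in [set t | 0 <= t]].
Proof.
split; first by exists (f (x + of_real s 0 *: y) - 0 * f y), 0 => /=.
by exists (- f (- x)) => _ [t /= t0 <-]; exact: flatten_along_lbound.
Qed.

Lemma flatten_along_le x t : 0 <= t ->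
  flatten_along f y x <= f (x + of_real s t *: y) - t * f y.
Proof.
by move=> t0; apply: ge_inf; [have [] := flatten_along_has_inf x|exists t].
Qed.

Lemma le_flatten_along x m :
  (forall t, 0 <= t -> m <= f (x + of_real s t *: y) - t * f y) ->
  m <= flatten_along f y x.
Proof.
move=> h; apply: lb_le_inf; first by have [] := flatten_along_has_inf x.
by move=> _ [t /= t0 <-]; exact: h.
Qed.

Lemma flatten_along_le_self x : flatten_along f y x <= f x.
Proof.
by have := flatten_along_le x (lexx 0); rewrite of_real0 scale0r addr0 mul0r subr0.
Qed.

Lemma flatten_along_le_sub x : flatten_along f y x <= f (x + y) - f y.
Proof. by have := flatten_along_le x ler01; rewrite of_real1 scale1r mul1r. Qed.

Lemma flatten_along_sublinear : sublinear (flatten_along f y).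
Proof.
apply: sublinear_from_le.
- apply/eqP; rewrite eq_le -[X in _ <= X](sublinear0 sf) flatten_along_le_self/=.
  apply: le_flatten_along => t t0.
  by have := flatten_along_lbound 0 t0; rewrite oppr0 (sublinear0 sf) oppr0.
- move=> x z; rewrite -lerBlDr; apply: le_flatten_along => t t0.
  rewrite lerBlDr -lerBlDl; apply: le_flatten_along => r r0; rewrite lerBlDl.
  apply: le_trans (flatten_along_le _ (addr_ge0 t0 r0)) _.
  have := sf.1 (x + of_real s t *: y) (z + of_real s r *: y).
  by rewrite of_realD scalerDl addrACA; lra.
- move=> t x t0; rewrite mulrC -ler_pdivrMr//; apply: le_flatten_along => r r0.
  rewrite ler_pdivrMr//; have tr0 : 0 <= t * r by rewrite mulr_ge0// ltW.
  apply: le_trans (flatten_along_le _ tr0) _.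
  rewrite of_realM -scalerA -scalerDr (sf.2 _ _ (ltW t0)).
  by rewrite -mulrA -mulrBr mulrC.
Qed.

End flatten_along_theory.

(** A pointwise minimal sublinear functional coincides with all of its
    flattenings, and is therefore additive. *)
Lemma minimal_sublinear_real_linear f : sublinear f ->
  (forall g, sublinear g -> (forall x, g x <= f x) -> g = f) -> real_linear f.
Proof.
move=> sf fmin.
have fD x y : f (x + y) = f x + f y.
  apply/eqP; rewrite eq_le sf.1/= -lerBrDr.
  rewrite -{1}(fmin _ (flatten_along_sublinear y sf)); last first.
    exact: flatten_along_le_self.
  exact: flatten_along_le_sub.
have fN x : f (- x) = - f x.
  by apply/eqP; rewrite -addr_eq0 -fD addNr sublinear0.
move=> t x y; rewrite fD; congr (_ + _).
have [t0|/ltW t0] := leP 0 t; first exact: sf.2.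
have := sf.2 (- t) x; rewrite oppr_ge0 => /(_ t0).
by rewrite of_realN scaleNr fN mulNr => /oppr_inj.
Qed.

(** Zorn's lemma for the reversed pointwise order on the sublinear minorants of
    [f]. The infimum of a chain is again sublinear: of two members of the chain
    one lies below the other, and it alone estimates the value at a sum. *)
Lemma minimal_sublinear_exists f : sublinear f -> exists g,
  [/\ sublinear g, forall x, g x <= f x &
      forall h, sublinear h -> (forall x, h x <= g x) -> h = g].
Proof.
move=> sf; pose T := {g : E -> R | sublinear g /\ forall x, g x <= f x}.
pose below (g h : T) : bool := `[< forall x, sval h x <= sval g x >].
have chain (A : set T) : total_on A below -> exists g, forall h, A h -> below h g.
  move=> totA; have [[h0 Ah0]|A0] := pselect (A !=set0); last first.
    exists (exist _ f (conj sf (fun=> lexx _))) => h Ah.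
    by exfalso; apply: A0; exists h.
  pose V x := [set sval h x | h in A].
  have Vinf x : has_inf (V x).
    split; first by exists (sval h0 x), h0.
    exists (- f (- x)) => _ [[h [sh hf]] Ah <-] /=.
    by apply: le_trans (sublinear_ge _ sh); rewrite lerN2.
  have Vle h x : A h -> inf (V x) <= sval h x.
    by move=> Ah; apply: ge_inf; [have [] := Vinf x|exists h].
  have leV m x : (forall h, A h -> m <= sval h x) -> m <= inf (V x).
    move=> hm; apply: lb_le_inf; first by have [] := Vinf x.
    by move=> _ [h Ah <-]; exact: hm.
  have sV : sublinear (fun x => inf (V x)).
    apply: sublinear_from_le.
    - apply/eqP; rewrite eq_le -{1}(sublinear0 (svalP h0).1) Vle//=.
      by apply: (leV) => h _; rewrite (sublinear0 (svalP h).1).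
    - move=> x y; rewrite -lerBlDr; apply: (leV) => h Ah.
      rewrite lerBlDr -lerBlDl; apply: (leV) => k Ak; rewrite lerBlDl.
      have [/asboolP kh|/asboolP hk] := totA _ _ Ah Ak.
        apply: le_trans (Vle k _ Ak) _; apply: le_trans ((svalP k).1.1 _ _) _.
        by rewrite lerD2r.
      apply: le_trans (Vle h _ Ah) _; apply: le_trans ((svalP h).1.1 _ _) _.
      by rewrite lerD2l.
    - move=> t x t0; rewrite mulrC -ler_pdivrMr//; apply: (leV) => h Ah.
      have := Vle h (of_real s t *: x) Ah; rewrite (svalP h).1.2 ?(ltW t0)//.
      by rewrite ler_pdivrMr// mulrC.
  have Vf x : inf (V x) <= f x.
    by apply: le_trans (Vle h0 x Ah0) _; exact: (svalP h0).2.
  exists (exist _ (fun x => inf (V x)) (conj sV Vf)) => h Ah.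
  by apply/asboolP => x /=; exact: Vle.
have [| | |[g [sg gf]] gmax] := Zorn _ _ _ chain.
- by move=> g; apply/asboolP.
- move=> g h k /asboolP gh /asboolP hk; apply/asboolP => x.
  exact: le_trans (hk x) (gh x).
- move=> [g [? ?]] [h [? ?]] /asboolP/= gh /asboolP/= hg; apply: eq_exist => /=.
  by apply/funext => x; apply/eqP; rewrite eq_le hg gh.
exists g; split => // h sh hg.
have hf x : h x <= f x by exact: le_trans (hg x) (gf x).
have /gmax/(congr1 sval) // : below (exist _ g (conj sg gf)) (exist _ h (conj sh hf)).
exact/asboolP.
Qed.

(** Flattening along [x0] brings the value at [- x0] down to [- f x0], so that
    every real-linear functional below attains the bound at [x0]. *)
Lemma real_hahn_banach f x0 : sublinear f ->
  exists g, [/\ real_linear g, forall x, g x <= f x & g x0 = f x0].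
Proof.
move=> sf.
have [g [sg gf gmin]] := minimal_sublinear_exists (flatten_along_sublinear x0 sf).
have gl := minimal_sublinear_real_linear sg gmin.
have gf' x : g x <= f x.
  by apply: le_trans (gf x) _; exact: flatten_along_le_self.
exists g; split => //; apply/eqP; rewrite eq_le gf'/=.
have : g (- x0) <= - f x0.
  apply: le_trans (gf _) _; apply: le_trans (flatten_along_le_sub _ sf _) _.
  by rewrite addNr (sublinear0 sf) sub0r.
by rewrite (real_linearN _ gl) lerN2.
Qed.

End hahn_banach.

Section functionals.
Variables (R : realType).

Lemma dual_of_dominated (s : scalars) (E : tvsType (scalar_field R s))
    (f : E -> (scalar_field R s)^o) (rho : E -> R) :
  linear f -> seminorm rho -> continuous rho ->
  (forall x, modulus (f x) <= rho x) -> exists chi : dual E, dual_fun chi = f.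
Proof.
move=> lf srho crho frho.
suff fP : f \in @Defs.linear_continuous _ E by exists (Dual fP).
apply/Defs.linear_continuousP; split => // x; apply/cvgrPdist_lt => e e0.
have me : 0 < modulus e by rewrite modulus_gt0 gt_eqF.
apply: filterS (nbhs_translate x (seminorm_nbhs0 srho crho me)) => y /= yx.
have -> : f x - f y = f (x - y).
  by have := lf (-1) y x; rewrite !scaleN1r ![- _ + _]addrC => ->.
rewrite -of_real_modulus -(pos_of_real e0) ltr_of_real.
by rewrite (le_lt_trans (frho _))// (seminorm_distC _ _ srho).
Qed.

Lemma real_linear_scalar_extension_real (E : tvsType (scalar_field R RealScalars))
    (f rho : E -> R) :
  real_linear f -> seminorm rho -> continuous rho -> (forall x, f x <= rho x) ->
  exists chi : dual E, forall x, f x <= modulus (chi x).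
Proof.
move=> lf srho crho frho.
have [||chi chiE] := @dual_of_dominated RealScalars E f rho _ srho crho.
- by move=> a x y; exact: lf.
- move=> x; rewrite /modulus ler_norml frho andbT lerNl -(real_linearN _ lf) -(seminormN x srho).
  exact: frho.
- by exists chi => x; rewrite chiE /modulus ler_norm.
Qed.

(** The complex functional with real part [f] is [x |-> f x - i f (i x)]. It is
    bounded by [rho] because rotating [x] turns its modulus into a value of [f]. *)
Lemma real_linear_scalar_extension_complex
    (E : tvsType (scalar_field R ComplexScalars)) (f rho : E -> R) :
  real_linear f -> seminorm rho -> continuous rho -> (forall x, f x <= rho x) ->
  exists chi : dual E, forall x, f x <= modulus (chi x).
Proof.
move=> lf srho crho frho.
pose I : scalar_field R ComplexScalars := ('i%C : R[i]).
have fD x y : f (x + y) = f x + f y.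
  by have := lf 1 x y; rewrite of_real1 scale1r mul1r.
have f0 := real_linear0 lf.
have fZ t x : f (of_real ComplexScalars t *: x) = t * f x.
  by have := lf t x 0; rewrite !addr0 f0 addr0.
have II : I * I = of_real ComplexScalars (-1).
  by rewrite of_realN of_real1; exact: (sqr_i R).
pose h (x : E) : (scalar_field R ComplexScalars)^o := Complex (f x) (- f (I *: x)).
have hl : linear h.
  move=> a x y.
  have -> : a = of_real ComplexScalars (complex.Re a)
              + I * of_real ComplexScalars (complex.Im a).
    exact: (complexE (a : R[i])).
  set al := complex.Re a; set be := complex.Im a.
  have E1 : f ((of_real ComplexScalars al + I * of_real ComplexScalars be) *: x)
      = al * f x + be * f (I *: x).
    by rewrite scalerDl fD fZ [I * _]mulrC -scalerA fZ.
  have E2 : f (I *: ((of_real ComplexScalars al + I * of_real ComplexScalars be) *: x))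
      = al * f (I *: x) - be * f x.
    rewrite scalerDl scalerDr fD; congr (_ + _).
      by rewrite scalerA mulrC -scalerA fZ.
    by rewrite scalerA mulrA II -of_realM fZ mulN1r mulNr.
  rewrite /h scalerDr !fD E1 E2.
  apply/eqP; rewrite eq_complex /=; apply/andP; split; apply/eqP; ring.
have hre x : f x = complex.Re (h x) by [].
have fh x : f x <= modulus (h x).
  rewrite -(ler_of_real ComplexScalars) of_real_modulus.
  by apply: le_trans (normc_ge_Re (h x)); rewrite lecR; exact: ler_norm.
have [|chi chiE] := @dual_of_dominated ComplexScalars E h rho hl srho crho.
  move=> x; have [h0|h0] := eqVneq (h x) 0.
    by rewrite h0 modulus0 seminorm_ge0.
  (* [u] rotates [h x] onto the positive half-line. *)
  pose u := `|h x| / h x.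
  have hu : h (u *: x) = `|h x|.
    have -> : h (u *: x) = u * h x.
      by have := hl u x 0; rewrite addr0 => ->; rewrite {2}/h f0 scaler0 f0 oppr0 addr0.
    by rewrite /u divfK.
  have -> : modulus (h x) = f (u *: x) by rewrite hre hu.
  apply: le_trans (frho _) _; rewrite srho.2 modulusM modulusV modulus_norm divff ?mul1r//.
  by rewrite gt_eqF// modulus_gt0.
by exists chi => x; rewrite chiE.
Qed.

Lemma real_linear_scalar_extension (s : scalars) (E : tvsType (scalar_field R s))
    (f rho : E -> R) :
  real_linear f -> seminorm rho -> continuous rho -> (forall x, f x <= rho x) ->
  exists chi : dual E, forall x, f x <= modulus (chi x).
Proof.
case: s E f rho => E f rho.
  exact: real_linear_scalar_extension_real.
exact: real_linear_scalar_extension_complex.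
Qed.

End functionals.

(** * Weakly bounded sets are bounded *)

Section gliding_hump.
Variables (R : realType) (s : scalars).
Local Notation K := (scalar_field R s).
Variables (E : tvsType K) (rho : E -> R).
Hypothesis srho : seminorm rho.

(** Partial sums of the series with terms [3^-n f n] up to sign, each sign being
    chosen so that the new term does not cancel the partial sum at [a n]. *)
Fixpoint hump (f : nat -> E -> R) (a : nat -> E) (n : nat) : E -> R :=
  if n is m.+1 then
    let g := hump f a m in
    let w := (if 0 <= g (a m) then 1 else -1) * 3^-1 ^+ m in
    fun x => g x + w * f m x
  else fun=> 0.

Variables (f : nat -> E -> R) (a : nat -> E).
Hypothesis lf : forall n, real_linear (f n).
Hypothesis f_le : forall n x, f n x <= rho x.
Hypothesis fa : forall n, f n (a n) = rho (a n).

Local Notation g := (hump f a).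
(** The sum of the weights [3^-k] over [k >= n]. *)
Let c n : R := 3 / 2 * 3^-1 ^+ n.

Let c_ge0 n : 0 <= c n.
Proof. by rewrite mulr_ge0// exprn_ge0// invr_ge0. Qed.

Let c_step n : 3^-1 ^+ n = c n - c n.+1.
Proof. by rewrite /c exprS; lra. Qed.

Lemma real_linear_norm_le (h : E -> R) x : real_linear h ->
  (forall y, h y <= rho y) -> `|h x| <= rho x.
Proof.
move=> lh hle; rewrite ler_norml hle andbT lerNl -(real_linearN _ lh).
by rewrite -(seminormN x srho).
Qed.

Lemma hump_linear n : real_linear (g n).
Proof.
elim: n => [|n IH] t x y /=; first by rewrite mulr0 addr0.
by rewrite IH lf; ring.
Qed.

Lemma hump_step n x : `|g n.+1 x - g n x| <= 3^-1 ^+ n * rho x.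
Proof.
rewrite /= addrAC subrr add0r !normrM.
have -> : `|if 0 <= g n (a n) then 1 else -1| = 1 :> R.
  by case: ifP => _; rewrite ?normrN normr1.
rewrite mul1r ger0_norm ?exprn_ge0 ?invr_ge0// ler_wpM2l ?exprn_ge0 ?invr_ge0//.
exact: real_linear_norm_le.
Qed.

Lemma hump_big n : 3^-1 ^+ n * rho (a n) <= `|g n.+1 (a n)|.
Proof.
rewrite /= fa; set w := 3^-1 ^+ n.
have wr : 0 <= w * rho (a n).
  by rewrite mulr_ge0 ?exprn_ge0 ?invr_ge0// seminorm_ge0.
case: ifP => [g0|/negbT]; first by rewrite mul1r ger0_norm ?addr_ge0// lerDr.
rewrite -ltNge => g0; rewrite mulN1r mulNr ler0_norm; lra.
Qed.

(** The partial sums at [x] are trapped between the nondecreasing [dn] and the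
    nonincreasing [up], which share one limit. *)
Let up n x := g n x + c n * rho x.
Let dn n x := g n x - c n * rho x.

Let up_step n x : up n.+1 x <= up n x.
Proof.
have := hump_step n x; rewrite c_step ler_norml => /andP[_].
by rewrite /up; lra.
Qed.

Let dn_step n x : dn n x <= dn n.+1 x.
Proof.
have := hump_step n x; rewrite c_step ler_norml => /andP[+ _].
by rewrite /dn; lra.
Qed.

Let dn_up m n x : dn m x <= up n x.
Proof.
have up_mono : {homo (fun k => up k x) : i j / (i <= j)%N >-> j <= i}.
  by apply/nonincreasing_seqP => k; exact: up_step.
have dn_mono : {homo (fun k => dn k x) : i j / (i <= j)%N >-> i <= j}.
  by apply/nondecreasing_seqP => k; exact: dn_step.
apply: le_trans (dn_mono _ _ (leq_maxl m n)) _.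
apply: le_trans _ (up_mono _ _ (leq_maxr m n)).
have : 0 <= c (maxn m n) * rho x by rewrite mulr_ge0 ?c_ge0 ?seminorm_ge0.
by rewrite /dn /up; lra.
Qed.

Let lim x := inf (range (fun n => up n x)).

Let lim_dist n x : `|lim x - g n x| <= c n * rho x.
Proof.
have hinf : has_inf (range (fun k => up k x)).
  split; first by exists (up 0 x), 0%N.
  by exists (dn 0 x) => _ [k _ <-]; exact: dn_up.
rewrite ler_norml; apply/andP; split.
  rewrite lerBrDl; apply: lb_le_inf; first by case: hinf.
  by move=> _ [k _ <-]; exact: dn_up.
rewrite lerBlDl; apply: ge_inf; first by case: hinf.
by exists n.
Qed.

(** The terms after the one of index [n] weigh [3^-n / 2] in all, so they cannot
    undo more than half of its contribution at [a n]. *)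
Lemma hump_limit : exists h : E -> R, [/\ real_linear h,
  forall x, `|h x| <= 3 / 2 * rho x &
  forall n, 3^-1 ^+ n / 2 * rho (a n) <= `|h (a n)|].
Proof.
exists lim; split.
- move=> t x y; apply/eqP; rewrite -subr_eq0 -normr_le0.
  pose B := rho (of_real s t *: x + y) + `|t| * rho x + rho y.
  have cB : (fun n => c n * B) @ \oo --> (0 : R).
    rewrite -(mul0r B); apply: cvgM; last exact: cvg_cst.
    rewrite -(mulr0 (3 / 2)); apply: cvgM; first exact: cvg_cst.
    by apply: cvg_expr; rewrite ger0_norm ?invr_ge0// invf_lt1// ltr1n.
  have cBl := cvg_lim (@Rhausdorff R) cB.
  rewrite -cBl; apply: limr_ge; first by apply/cvg_ex; exists 0.
  near=> n.
  have h1 := lim_dist n (of_real s t *: x + y).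
  have h2 := ler_wpM2l (normr_ge0 t) (lim_dist n x).
  have h3 := lim_dist n y.
  rewrite -normrM in h2.
  have -> : lim (of_real s t *: x + y) - (t * lim x + lim y) =
    (lim (of_real s t *: x + y) - g n (of_real s t *: x + y))
    - t * (lim x - g n x) - (lim y - g n y).
    by rewrite (hump_linear n); ring.
  have := ler_normB ((lim (of_real s t *: x + y) - g n (of_real s t *: x + y))
    - t * (lim x - g n x)) (lim y - g n y).
  have := ler_normB (lim (of_real s t *: x + y) - g n (of_real s t *: x + y))
    (t * (lim x - g n x)).
  have -> : c n * B = c n * rho (of_real s t *: x + y) + `|t| * (c n * rho x) + c n * rho y.
    by rewrite /B; ring.
  by lra.
- by move=> x; have := lim_dist 0 x; rewrite /c expr0 mulr1 subr0.
- move=> n; have := lim_dist n.+1 (a n); have := hump_big n.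
  have -> : c n.+1 = 3^-1 ^+ n / 2 by rewrite /c exprS; lra.
  have := ler_normD (lim (a n)) (g n.+1 (a n) - lim (a n)).
  have -> : lim (a n) + (g n.+1 (a n) - lim (a n)) = g n.+1 (a n) by ring.
  rewrite (distrC (g n.+1 (a n))).
  by lra.
Unshelve. all: by end_near. Qed.

End gliding_hump.

Lemma seminorm_sublinear (R : realType) (s : scalars) (E : tvsType (scalar_field R s))
  (rho : E -> R) : seminorm rho -> sublinear rho.
Proof.
move=> h; split; first exact: h.1.
by move=> t x t0; rewrite h.2 modulus_of_real ger0_norm.
Qed.

(** Mackey's theorem. If [rho] were unbounded on [A], norming functionals of points
    of [A] on which [rho] grows faster than [3^n] could be summed by the gliding
    hump into one continuous functional unbounded on [A]. *)
Lemma weakly_bounded_seminorm_bounded (R : realType) (s : scalars)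
    (E : tvsType (scalar_field R s)) (A : set E) (rho : E -> R) :
  (forall chi : dual E, has_ubound [set modulus (chi x) | x in A]) ->
  seminorm rho -> continuous rho -> has_ubound [set rho x | x in A].
Proof.
move=> wA srho crho; apply: contrapT => nb.
have big n : exists x, A x /\ 2 * n%:R * 3 ^+ n < rho x.
  apply: contrapT => nx; apply: nb; exists (2 * n%:R * 3 ^+ n) => _ [x Ax <-].
  by rewrite leNgt; apply/negP => xn; apply: nx; exists x.
have [a aP] := choice big.
have [f fP] := choice (fun n => real_hahn_banach (a n) (seminorm_sublinear srho)).
have [h [lh hle ha]] := hump_limit srho (fun n => let: And3 l _ _ := fP n in l)
  (fun n => let: And3 _ l _ := fP n in l) (fun n => let: And3 _ _ l := fP n in l).
have [chi chiP] : exists chi : dual E, forall x, h x <= modulus (chi x).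
  apply: (@real_linear_scalar_extension _ _ _ _ (fun x => 3 / 2 * rho x)) => //.
  - split=> [x y|b x]; first by rewrite -mulrDr ler_wpM2l//; exact: srho.1.
    by rewrite srho.2; ring.
  - by move=> x; apply: cvgM; [exact: cvg_cst|exact: crho].
  - by move=> x; apply: le_trans (hle x); exact: ler_norm.
have [M MP] := wA chi.
have nM n : n%:R <= M.
  apply: (@le_trans _ _ `|h (a n)|); last first.
    apply: (@le_trans _ _ (modulus (chi (a n)))); last first.
      by apply: MP; exists (a n) => //; have [] := aP n.
    rewrite ler_norml chiP andbT lerNl -(real_linearN _ lh).
    by apply: le_trans (chiP _) _; rewrite linearN modulusN.
  apply: le_trans (ha n); have [_ /ltW an] := aP n.
  have w0 : 0 <= 3^-1 ^+ n / 2 :> R by rewrite divr_ge0// exprn_ge0// invr_ge0.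
  apply: le_trans (ler_wpM2l w0 an).
  by rewrite exprVn le_eqVlt; apply/orP; left; apply/eqP; field; rewrite expf_neq0.
have := nM (Num.truncn M).+1; apply/negP; rewrite -ltNge.
exact: truncnS_gt.
Qed.

(** * Summability, compactness classes and adjoints *)

Section ell_theory.
Variable R : realType.
Implicit Types (p : \bar R) (u v : nat -> R).

Lemma ell_dominated p u v (C : R) : (1%:E <= p)%E -> 0 <= C ->
  (forall n, `|u n| <= C * `|v n|) -> ell p v -> ell p u.
Proof.
case: p => [r| |]; last (by []); rewrite ?lee_fin => p1 C0 uv /=.
  have r0 : 0 <= r by apply: le_trans p1.
  move=> cv; apply: (series_le_cvg _ _ _ (@is_cvg_seriesZ _ _ (C `^ r) cv)) => n.
  - exact: powR_ge0.
  - by rewrite /= mulr_ge0 ?powR_ge0.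
  - change (`|u n| `^ r <= C `^ r * `|v n| `^ r).
    rewrite -powRM// ge0_ler_powR ?nnegrE//.
    by rewrite mulr_ge0.
move=> v0; apply/cvgr0Pnorm_le => e e0.
have C1 : 0 < C + 1 by rewrite ltr_wpDl.
move/cvgr0_norm_le: v0 => /(_ _ (divr_gt0 e0 C1)).
apply: filterS => n; rewrite ler_pdivlMr// => ve.
apply: le_trans (uv n) _; apply: le_trans ve.
by rewrite mulrC ler_wpM2l// lerDl.
Qed.

Lemma ell_supported_at0 p u : (1%:E <= p)%E -> (forall n, u n.+1 = 0) -> ell p u.
Proof.
case: p => [r| |]; last (by []); rewrite ?lee_fin => p1 u0 /=.
  have r0 : r != 0 by rewrite gt_eqF// (lt_le_trans ltr01).
  apply/cvg_ex; exists (`|u 0%N| `^ r); apply: cvg_near_cst; near=> n.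
  have n0 : (0 < n)%N by near: n; exists 1%N.
  rewrite /series/= big_ltn// big_nat_cond big1 ?addr0// => i.
  by case: i => // i _; rewrite u0 normr0 powR0.
apply: cvg_near_cst; near=> n.
rewrite -(@prednK n) ?u0//.
by near: n; exists 1%N.
Unshelve. all: by end_near. Qed.

End ell_theory.

Section classes.
Variables (R : realType) (s : scalars).
Local Notation K := (scalar_field R s).

Lemma weakly_summableZ (F : tvsType K) p (x : nat -> F) (a : K) :
  (1%:E <= p)%E -> weakly_summable p x -> weakly_summable p (fun n => a *: x n).
Proof.
move=> p1 xp chi; apply: ell_dominated p1 (modulus_ge0 a) _ (xp chi) => n.
by rewrite linearZ/= !ger0_norm ?modulus_ge0// -modulusM.
Qed.

(** All six notions of compactness ask that every sequence of the set have a
    subsequence with a property of its own; naming it lets them be treated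
    together. *)
Definition sequence_in_class (c : compactness) p (E : tvsType K) (y : nat -> E) :
    Prop :=
  match c with
  | WeaklySequentiallyCompact =>
      exists l : weak_space E, (y : nat -> weak_space E) @ \oo --> l
  | SequentiallyCompact => exists l : E, y @ \oo --> l
  | WeaklySequentiallyPrecompact =>
      @cauchy_sequence R s (weak_space E) y
  | SequentiallyPrecompact => cauchy_sequence y
  | WeaklySequentiallyPCompact => exists l : E, weakly_p_convergent p y l
  | WeaklySequentiallyPPrecompact => weakly_p_cauchy p y
  end.

Lemma subset_in_classE c p (E : tvsType K) (A : set E) :
  subset_in_class c p A = has_subsequence A (@sequence_in_class c p E).
Proof. by case: c. Qed.

Lemma cvg_sequenceZ (E : tvsType K) (y : nat -> E) (a : K) (l : E) :
  y @ \oo --> l -> (fun n => a *: y n) @ \oo --> a *: l.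
Proof. by move=> yl; apply: (cvgZ_tvs (k := fun=> a)) => //; exact: cvg_cst. Qed.

Lemma cauchy_sequenceZ (E : tvsType K) (y : nat -> E) (a : K) : a != 0 ->
  cauchy_sequence y -> cauchy_sequence (fun n => a *: y n).
Proof.
move=> a0 cy U /(nbhs0_scale a0)/cy[N yN]; exists N => m n Nm Nn.
by rewrite -scalerBr; exact: yN.
Qed.

Lemma sequence_in_classZ c p (E : tvsType K) (y : nat -> E) (a : K) :
  (1%:E <= p)%E -> a != 0 ->
  sequence_in_class c p y -> sequence_in_class c p (fun n => a *: y n).
Proof.
move=> p1 a0; case: c => /=.
- by move=> [l yl]; exists (a *: l); exact: (@cvg_sequenceZ (weak_space E)).
- by move=> [l yl]; exists (a *: l); exact: cvg_sequenceZ.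
- exact: (@cauchy_sequenceZ (weak_space E)).
- exact: cauchy_sequenceZ.
- move=> [l yl]; exists (a *: l); rewrite /weakly_p_convergent.
  under eq_fun do rewrite -scalerBr.
  exact: weakly_summableZ.
- move=> yc k j ki ji; under eq_fun do rewrite -scalerBr.
  by apply: weakly_summableZ => //; exact: yc.
Qed.

(** The notions of compactness look at one sequence at a time and are invariant
    under dilation, so the comparison set [B] may depend on the sequence. *)
Lemma subset_in_class_dilate c p (E : tvsType K) (A : set E) :
  (1%:E <= p)%E ->
  (forall x : nat -> E, (forall n, A (x n)) -> exists2 B,
    subset_in_class c p B & exists2 a : K, a != 0 & forall n, B (a *: x n)) ->
  subset_in_class c p A.
Proof.
move=> p1 h; rewrite subset_in_classE => x /h[B].
rewrite subset_in_classE => cB [a a0 /cB[phi phi_incr yphi]].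
exists phi => //.
have a0' : a^-1 != 0 by rewrite invr_eq0.
have := sequence_in_classZ p1 a0' yphi.
rewrite (_ : (fun n => _) = x \o phi)//; apply/funext => n /=.
by rewrite scalerA mulVf// scale1r.
Qed.

End classes.

Section adjoint_convergence.
Variables (R : realType) (s : scalars).
Local Notation K := (scalar_field R s).

Lemma seminorm_le_norm (L : normedModType K) (rho : L -> R) :
  seminorm rho -> continuous rho ->
  exists2 C : R, 0 <= C & forall x, rho x <= C * modulus `|x|.
Proof.
move=> srho crho; have := seminorm_nbhs0 srho crho ltr01.
move=> /nbhs_norm0P[e/= e0 eP].
have me : 0 < modulus e by rewrite modulus_gt0 gt_eqF.
exists (2 / modulus e); first by rewrite divr_ge0// ltW.
move=> x; have [->|x0] := eqVneq x 0.
  by rewrite seminorm0// normr0 modulus0 mulr0.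
have mx : 0 < modulus `|x| by rewrite modulus_gt0 normr_eq0.
pose t : R := modulus e / 2 / modulus `|x|.
have t0 : 0 < t by rewrite !divr_gt0.
have nx : of_real s (modulus `|x|) = `|x| by rewrite of_real_modulus normr_id.
have te : t * modulus `|x| = modulus e / 2 by rewrite /t divfK// gt_eqF.
have := eP (of_real s t *: x); rewrite /= normrZ normr_of_real (gtr0_norm t0).
rewrite -nx -of_realM te srho.2 modulus_of_real (gtr0_norm t0).
rewrite -[X in _ < X -> _](pos_of_real e0) ltr_of_real ltr_pdivrMr// ltr_pMr//.
rewrite ltr1n => /(_ isT).
move=> /ltW h; have -> : rho x = 2 / modulus e * modulus `|x| * (t * rho x).
  by rewrite /t; field; rewrite !gt_eqF.
by rewrite nx ler_piMr// mulr_ge0 ?divr_ge0 ?ltW.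
Qed.

Section op_norm.
Variable L : normedModType K.

Lemma op_norm_seminorm : seminorm (@op_norm R s L : strong_dual L -> R).
Proof. by split=> [x y|a x]; [exact: op_normD|exact: op_normZ]. Qed.

Lemma op_norm_continuous : continuous (@op_norm R s L : strong_dual L -> R).
Proof.
apply: seminorm_continuous; first exact: op_norm_seminorm.
have := @nbhs_norm0P K (strong_dual L) [set chi | op_norm chi < 1].
move=> [_]; apply; exists 1; first exact: ltr01.
move=> chi; change (of_real s (op_norm chi) < 1 -> op_norm chi < 1).
by rewrite -of_real1 ltr_of_real.
Qed.

Lemma modulus_strong_norm (chi : strong_dual L) : modulus `|chi| = op_norm chi.
Proof.
change (modulus (of_real s (op_norm chi)) = op_norm chi).
by rewrite modulus_of_real ger0_norm// op_norm_ge0.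
Qed.

Variables (E : tvsType K) (T : {linear L -> E}) (cT : continuous T).
Variables p q : \bar R.
Hypothesis q1 : (1%:E <= q)%E.

(** A continuous seminorm on the strong dual is dominated by a multiple of the
    norm, which therefore decides strong summability. *)
Lemma qp_convergent_adjointP : qp_convergent q p (adjoint cT) <->
  forall chi : nat -> weak_star E, weakly_summable p chi ->
    ell q (fun n => op_norm (adjoint cT (chi n))).
Proof.
split=> [h chi /h|h chi /h chiq rho srho crho].
  move=> /(_ (@op_norm R s L)) hT; apply: hT.
    exact: op_norm_seminorm.
  exact: op_norm_continuous.
have [C C0 rhoC] := seminorm_le_norm srho crho.
apply: ell_dominated q1 C0 _ chiq => n.
rewrite !ger0_norm ?op_norm_ge0 ?seminorm_ge0//.
by rewrite -modulus_strong_norm; exact: rhoC.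
Qed.

Lemma image_ball_limited : qp_convergent q p (adjoint cT) ->
  limited p q (T @` [set x | `|x| <= 1]).
Proof.
move=> /qp_convergent_adjointP h; split.
  by exists (T 0), 0 => //=; rewrite normr0.
have E0 (chi : weak_star E) :
    [set modulus ((chi : dual E) a) | a in T @` [set x | `|x| <= 1]] =
    [set modulus (adjoint cT chi x) | x in [set x : L | `|x| <= 1]].
  by rewrite image_comp.
move=> chi /h chiq; split=> [n|].
  by rewrite E0; have [] := op_norm_has_sup (adjoint cT (chi n)).
by under eq_fun do rewrite E0.
Qed.

End op_norm.

(** The norm of the adjoint at [chi] is the supremum of [chi] over the image of the
    unit ball, so convergence of the adjoint makes that image limited; and the
    unit ball is a neighbourhood of zero. *)
Lemma adjoint_convergent_in_class_of_limited c p q (E : tvsType K) :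
  (1%:E <= q)%E -> (forall A : set E, limited p q A -> subset_in_class c p A) ->
  forall L : normedModType K, adjoint_convergent_in_class c p q L E.
Proof.
move=> q1 iii L T cT /(image_ball_limited q1)/iii TB.
exists [set x | `|x| <= 1] => //.
by apply/nbhs_norm0P; exists 1 => //= x /ltW.
Qed.

End adjoint_convergence.

(** * Synthesis operators *)

(** The sequences [chi, 0, 0, ...] are weakly summable, so a limited set is weakly
    bounded; Mackey's theorem does the rest. *)
Lemma limited_seminorm_bounded (R : realType) (s : scalars)
    (E : tvsType (scalar_field R s)) (p q : \bar R) (A : set E) (rho : E -> R) :
  (1%:E <= p)%E -> limited p q A -> seminorm rho -> continuous rho ->
  has_ubound [set rho x | x in A].
Proof.
move=> p1 [_ limA]; apply: weakly_bounded_seminorm_bounded => chi.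
have [|+ _] := limA (fun n => if n is 0%N then chi else 0).
  by move=> F; apply: ell_supported_at0 => // n; rewrite linear0 modulus0.
by move=> /(_ 0%N).
Qed.

(** A normed space between the span of the unit vectors and [l1], given by its
    coordinate map [j]; this treats [l1_0] and [l1] at once. *)
Section synthesis.
Variables (R : realType) (s : scalars).
Local Notation K := (scalar_field R s).
Variables (L : normedModType K) (j : L -> l1 R s) (e : nat -> L).
Hypothesis j_linear : forall (a : K) u v, j (a *: u + v) = a *: j u + j v.
Hypothesis j_norm : forall u, `|j u| = `|u|.
Hypothesis j_e : forall i, j (e i) = unit_vector R s i.

Lemma sum_modulus_le (u : L) n :
  \sum_(k < n) modulus (j u k) <= modulus `|u|.
Proof.
rewrite -j_norm.
have -> : modulus `|j u| = l1_sum (j u).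
  change (modulus (of_real s (l1_sum (j u))) = l1_sum (j u)).
  rewrite modulus_of_real ger0_norm//.
  by apply: le_trans (l1_sum_ub (j u) 0); rewrite seriesEnat/= big_geq.
by apply: le_trans (l1_sum_ub (j u) n); rewrite seriesEnat/= big_mkord.
Qed.

Lemma norm_e i : modulus `|e i| <= 1.
Proof.
rewrite -j_norm j_e.
have -> : modulus `|unit_vector R s i| = `|l1_sum (unit_vector R s i)|.
  by rewrite -(modulus_of_real s).
have le1 : l1_sum (unit_vector R s i) <= 1.
  apply: limr_le; first exact: l1_cvg.
  apply: nearW => n; rewrite seriesEnat/= big_mkord.
  have [ni|ni] := leqP n i.
    rewrite big1// => k _.
    by rewrite (ltn_eqF (leq_trans (ltn_ord k) ni)) modulus0.
  rewrite (bigD1 (Ordinal ni))//= eqxx big1 ?addr0 ?modulus1// => k.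
  by rewrite -val_eqE/= => /negbTE ->; exact: modulus0.
rewrite ger0_norm//.
by apply: le_trans (l1_sum_ub _ 0); rewrite seriesEnat/= big_geq.
Qed.

Variables (E : tvsType K) (hE : hausdorff_space E) (x : nat -> E).
Hypothesis x_bounded : forall rho : E -> R, seminorm rho -> continuous rho ->
  exists M, forall n, rho (x n) <= M.
Hypothesis x_series : forall u : L, exists l : E,
  (fun n => \sum_(k < n) j u k *: x k) @ \oo --> l.

(** The operator sends [u] to the sum of the series [j u k *: x k]. The bound, for
    an arbitrary continuous seminorm, gives both the continuity of [T] and, applied
    to the modulus of a functional, the estimate of the adjoint. *)
Lemma synthesis_operator : exists (T : {linear L -> E}) (cT : continuous T),
  (forall i, T (e i) = x i) /\
  forall (rho : E -> R) (M : R), seminorm rho -> continuous rho ->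
    (forall n, rho (x n) <= M) -> forall u, rho (T u) <= M * modulus `|u|.
Proof.
have [T0 T0P] := choice x_series.
have cvg_eq (f : nat -> E) (l l' : E) : f @ \oo --> l -> f @ \oo --> l' -> l = l'.
  by move=> fl fl'; exact: (cvg_unique hE fl fl').
have lT : linear T0.
  move=> a u v; apply: cvg_eq (T0P _) _.
  rewrite (_ : (fun n => _) = (fun n => a *: (\sum_(k < n) j u k *: x k) +
      \sum_(k < n) j v k *: x k)).
    exact: cvgD_tvs (cvg_sequenceZ (T0P u)) (T0P v).
  apply/funext => n; rewrite scaler_sumr -big_split; apply: eq_bigr => k _.
  by rewrite /= scalerA -scalerDl j_linear.
have T0e i : T0 (e i) = x i.
  apply: cvg_eq (T0P _) _; apply: cvg_near_cst; near=> n.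
  have ni : (i < n)%N by near: n; exists i.+1.
  rewrite (bigD1 (Ordinal ni))//= big1 ?addr0 => [|k].
    by rewrite j_e /= eqxx scale1r.
  by rewrite j_e -val_eqE/= => /negbTE ->; rewrite scale0r.
have T0_bound (rho : E -> R) (M : R) : seminorm rho -> continuous rho ->
    (forall n, rho (x n) <= M) -> forall u, rho (T0 u) <= M * modulus `|u|.
  move=> srho crho xM u.
  have M0 : 0 <= M by apply: le_trans (xM 0%N); exact: seminorm_ge0.
  have cu : (fun n => rho (\sum_(k < n) j u k *: x k)) @ \oo --> rho (T0 u).
    exact: (continuous_cvg _ (crho _) (T0P u)).
  rewrite -(cvg_lim (@Rhausdorff R) cu); apply: limr_le.
    by apply/cvg_ex; exists (rho (T0 u)).
  apply: nearW => n.
  apply: le_trans (seminorm_sum n (fun k => j u k *: x k) srho) _.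
  apply: (@le_trans _ _ (\sum_(k < n) M * modulus (j u k))).
    apply: ler_sum => k _; rewrite srho.2 mulrC.
    by rewrite ler_wpM2r ?modulus_ge0.
  by rewrite -mulr_sumr ler_wpM2l// sum_modulus_le.
pose T : {linear L -> E} := HB.pack T0 (GRing.isLinear.Build _ _ _ _ T0 lT).
have cT : continuous T.
  move=> u; apply: seminorm_cvg => rho srho crho.
  have [M xM] := x_bounded srho crho.
  have M0 : 0 <= M by apply: le_trans (xM 0%N); exact: seminorm_ge0.
  have d0 : 0 < of_real s (M + 1)^-1.
    by rewrite -(of_real0 R s) ltr_of_real invr_gt0 ltr_wpDl.
  apply/nbhs_normP; exists (of_real s (M + 1)^-1) => // v /=.
  rewrite -[`|u - v|]normr_id -of_real_modulus ltr_of_real => uv; change (rho (T v - T u) < 1).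
  rewrite -linearB; apply: le_lt_trans (T0_bound _ _ srho crho xM _) _.
  rewrite -normrN opprB.
  apply: (@le_lt_trans _ _ (M * (M + 1)^-1)); first by rewrite ler_wpM2l// ltW.
  by rewrite ltr_pdivrMr ?ltr_wpDl// mul1r ltrDl.
by exists T, cT.
Unshelve. all: by end_near. Qed.

(** A limited set is bounded, so each of its sequences is the image of the unit
    vectors under a synthesis operator, whose adjoint is dominated by the
    suprema over the set. *)
Lemma subset_in_class_of_synthesis c (p q : \bar R) (A : set E) :
  (1%:E <= p)%E -> (p <= q)%E -> adjoint_convergent_in_class c p q L E ->
  limited p q A -> (forall n, A (x n)) ->
  exists2 B, subset_in_class c p B & exists2 a : K, a != 0 & forall n, B (a *: x n).
Proof.
move=> p1 pq LE limA xA; have q1 := le_trans p1 pq.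
have [T [cT [Te Tb]]] := synthesis_operator.
have adjT : qp_convergent q p (adjoint cT).
  apply/(qp_convergent_adjointP cT p q1) => chi chip.
  have [bA Aq] := limA.2 chi chip.
  apply: ell_dominated q1 ler01 _ Aq => n; rewrite mul1r.
  rewrite ger0_norm ?op_norm_ge0//; apply: le_trans (ler_norm _).
  have chix k : modulus ((chi n : dual E) (x k)) <=
      sup [set modulus ((chi n : dual E) a) | a in A].
    by apply: ub_le_sup; [exact: bA|exists (x k)].
  have S0 := le_trans (modulus_ge0 _) (chix 0%N).
  apply: op_norm_le => u u1.
  change (modulus ((chi n : dual E) (T u)) <=
    sup [set modulus ((chi n : dual E) a) | a in A]).
  have := Tb _ _ (seminorm_dual (chi n : dual E))
    (@dual_seminorm_continuous _ _ _ (chi n : dual E)) chix u.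
  move=> /le_trans; apply.
  by rewrite ler_piMr// -(ler_of_real s) of_real_modulus normr_id of_real1.
have [U U0 TU] := LE T cT adjT.
exists (T @` U) => //.
have /nbhs_norm0P[r/= r0 rU] := U0.
exists (r / 2); first by rewrite mulf_neq0 ?invr_eq0// gt_eqF.
move=> n; exists (r / 2 *: e n); last by rewrite linearZ/= Te.
apply: rU; rewrite /= normrZ gtr0_norm ?divr_gt0//.
apply: (@le_lt_trans _ _ (r / 2)).
  rewrite ler_piMr//; first by rewrite divr_ge0// ltW.
  by rewrite -[`|e n|]normr_id -of_real_modulus -of_real1 ler_of_real norm_e.
by rewrite ltr_pdivrMr// ltr_pMr// ltr1n.
Qed.

End synthesis.

(** * Series in locally complete spaces *)

(** Induction on [n]: the first [n] terms, divided by the sum [t] of their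
    coefficients, fall under the induction hypothesis. *)
Lemma absolutely_convex_sum (R : realType) (s : scalars)
    (E : tvsType (scalar_field R s)) (A : set E) (y : nat -> E) n
    (b : nat -> scalar_field R s) :
  absolutely_convex A -> (forall k, A (y k)) -> \sum_(k < n) `|b k| <= 1 ->
  A (\sum_(k < n) b k *: y k).
Proof.
move=> aA Ay; elim: n b => [|n IH] b b1.
  rewrite big_ord0; have := aA 0 0 _ _ (Ay 0%N) (Ay 0%N).
  by rewrite !scale0r addr0 normr0 addr0; apply; exact: ler01.
rewrite big_ord_recr/= in b1; rewrite big_ord_recr/=.
set t := \sum_(k < n) `|b k| in b1.
have t0 : 0 <= t by exact: sumr_ge0.
(* If [t = 0], all the coefficients vanish and dividing by [t] does no harm. *)
have bE (k : 'I_n) : b k = t * (b k / t).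
  have [tE|tN] := eqVneq t 0; last by rewrite mulrC divfK.
  rewrite tE mul0r; apply/normr0_eq0.
  exact: (psumr_eq0P (fun i _ => normr_ge0 (b (nat_of_ord i))) tE).
have -> : \sum_(k < n) b k *: y k = t *: \sum_(k < n) (b k / t) *: y k.
  by rewrite scaler_sumr; apply: eq_bigr => k _; rewrite scalerA -bE.
apply: aA => //; last by rewrite (ger0_norm t0).
apply: (IH (fun k => b k / t)).
under eq_bigr do rewrite normrM normfV (ger0_norm t0).
rewrite -mulr_suml -/t; have [->|tN] := eqVneq t 0; first by rewrite mul0r ler01.
by rewrite divff.
Qed.

Section l1_tail.
Variables (R : realType) (s : scalars) (u : l1 R s).

Definition l1_tail n : R := l1_sum u - series (fun k => modulus (u k)) n.

Lemma l1_tail_ge0 n : 0 <= l1_tail n.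
Proof. by rewrite subr_ge0 l1_sum_ub. Qed.

Lemma l1_tail_step n : modulus (u n) = l1_tail n - l1_tail n.+1.
Proof.
rewrite /l1_tail !seriesEnat/= big_nat_recr//=.
by ring.
Qed.

Lemma l1_tail_cvg0 : l1_tail @ \oo --> (0 : R).
Proof.
rewrite -(subrr (l1_sum u)); apply: cvgB; first exact: cvg_cst.
exact: l1_cvg.
Qed.

Lemma sum_modulus_le_tail n d :
  \sum_(k < d) modulus (u (n + k)%N) <= l1_tail n.
Proof.
suff -> : \sum_(k < d) modulus (u (n + k)%N) = l1_tail n - l1_tail (n + d)%N.
  by rewrite lerBlDr lerDl l1_tail_ge0.
elim: d => [|d IH]; first by rewrite big_ord0 addn0 subrr.
by rewrite big_ord_recr/= IH l1_tail_step addnS; ring.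
Qed.

(** With [P] and [Q] the square roots of two consecutive tails, a quotient is
    [(P^2 - Q^2) / P <= 2 (P - Q)], and these bounds telescope. *)
Lemma sum_modulus_div_sqrt_tail n :
  \sum_(k < n) modulus (u k) / Num.sqrt (l1_tail k) <=
  2 * Num.sqrt (l1_tail 0).
Proof.
suff h : \sum_(k < n) modulus (u k) / Num.sqrt (l1_tail k) <=
    2 * (Num.sqrt (l1_tail 0) - Num.sqrt (l1_tail n)).
  by apply: le_trans h _; rewrite ler_wpM2l// lerBlDr lerDl sqrtr_ge0.
elim: n => [|n IH]; first by rewrite big_ord0 subrr mulr0.
rewrite big_ord_recr/=; set P := Num.sqrt (l1_tail n) in IH *.
set Q := Num.sqrt (l1_tail n.+1).
have P0 : 0 <= P by exact: sqrtr_ge0.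
have Q0 : 0 <= Q by exact: sqrtr_ge0.
have PQ : Q <= P.
  by rewrite ler_sqrt ?l1_tail_ge0// -subr_ge0 -l1_tail_step modulus_ge0.
suff : modulus (u n) / P <= 2 * (P - Q) by lra.
have [PE|PN] := eqVneq P 0; first by rewrite {1}PE invr0 mulr0 mulr_ge0// subr_ge0.
rewrite ler_pdivrMr ?lt_neqAle ?P0 1?eq_sym ?PN// l1_tail_step.
rewrite -(sqr_sqrtr (l1_tail_ge0 n)) -(sqr_sqrtr (l1_tail_ge0 n.+1)) -/P -/Q.
by nra.
Qed.

End l1_tail.

(** In a locally complete space a series [u k *: x k] with [u] absolutely
    summable and [x] bounded is rewritten as an absolutely convex series in the
    null sequence [y k], a multiple of [sqrt (l1_tail k) *: x k]: its partial
    sums are a Cauchy sequence in a compact set. *)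
Lemma locally_complete_l1_series (R : realType) (s : scalars)
    (E : tvsType (scalar_field R s)) (x : nat -> E) (u : l1 R s) :
  locally_complete E ->
  (forall rho : E -> R, seminorm rho -> continuous rho ->
    exists M, forall n, rho (x n) <= M) ->
  exists l : E, (fun n => \sum_(k < n) u k *: x k) @ \oo --> l.
Proof.
move=> lcE xb.
pose S n := \sum_(k < n) u k *: x k.
(* [C] dominates the sum of the quotients by the square roots of the tails. *)
pose C : R := 2 * Num.sqrt (l1_tail u 0) + 1.
have C0 : 0 < C by rewrite ltr_wpDl// mulr_ge0// sqrtr_ge0.
pose w k : R := C * Num.sqrt (l1_tail u k).
have w0 k : 0 <= w k by rewrite mulr_ge0 ?sqrtr_ge0// ltW.
pose y k := of_real s (w k) *: x k.
pose b k := u k / of_real s (w k).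
(* If the tail at [k] vanishes then [y k = 0], but [u k = 0] as well. *)
have by_ux k : b k *: y k = u k *: x k.
  rewrite /y scalerA; congr (_ *: _).
  have [wE|wN] := eqVneq (w k) 0; last by rewrite divfK// of_real_eq0.
  have /eqP := wE; rewrite mulf_eq0 gt_eqF//= sqrtr_eq0 => tail0.
  rewrite wE of_real0 mulr0; apply/esym/modulus_eq0/eqP.
  rewrite eq_le modulus_ge0 andbT (le_trans _ tail0)//.
  by rewrite l1_tail_step lerBlDr lerDl l1_tail_ge0.
have b1 n : \sum_(k < n) `|b k| <= 1.
  have -> : \sum_(k < n) `|b k| = of_real s (\sum_(k < n) modulus (b k)).
    rewrite (big_morph _ (@of_realD R s) (of_real0 R s)).
    by apply: eq_bigr => k _; rewrite of_real_modulus.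
  rewrite -of_real1 ler_of_real.
  have -> : \sum_(k < n) modulus (b k) =
      (\sum_(k < n) modulus (u k) / Num.sqrt (l1_tail u k)) / C.
    rewrite mulr_suml; apply: eq_bigr => k _.
    rewrite modulusM modulusV modulus_of_real ger0_norm// /w invfM.
    by rewrite -mulrA [_ / C]mulrC.
  rewrite ler_pdivrMr// mul1r; apply: le_trans (sum_modulus_div_sqrt_tail u n) _.
  by rewrite lerDl.
have ynull : y @ \oo --> (0 : E).
  apply: seminorm_cvg => rho srho crho; have [M xM] := xb rho srho crho.
  have wM : (fun k => w k * M) @ \oo --> (0 : R).
    rewrite -(mul0r M); apply: cvgM; last exact: cvg_cst.
    rewrite -(mulr0 C); apply: cvgM; first exact: cvg_cst.
    rewrite -(@sqrtr0 R); apply: continuous_cvg; last exact: l1_tail_cvg0.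
    exact: sqrt_continuous.
  near=> k; rewrite subr0 srho.2 modulus_of_real ger0_norm//.
  apply: (@le_lt_trans _ _ (w k * M)); first by rewrite ler_wpM2l.
  by near: k; apply: (cvgr_lt 0 wM); exact: ltr01.
pose H := smallest (@absolutely_convex R s E) (range y).
have SH n : H (S n).
  rewrite /S; under eq_bigr do rewrite -by_ux.
  move=> A [aA yA]; apply: absolutely_convex_sum => //.
  by move=> k; apply: yA; exists k.
have SK : (S @ \oo) (closure H) by exists 0%N => // n _; exact: subset_closure.
have [l [_ lS]] := lcE y ynull (S @ \oo) _ SK.
exists l; apply: seminorm_cvg => rho srho crho; have [M xM] := xb rho srho crho.
have rM : (fun n => M * l1_tail u n) @ \oo --> (0 : R).
  by rewrite -(mulr0 M); apply: cvgM; [exact: cvg_cst|exact: l1_tail_cvg0].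
have h2 : 0 < 2^-1 :> R by rewrite invr_gt0.
(* A partial sum close to the cluster point [l], of index [m >= n], is also close
   to [S n]. *)
near=> n.
have : ([set S m | m in [set m | (n <= m)%N]] `&` [set z | rho (z - l) < 2^-1]) !=set0.
  apply: lS; first by exists n => // m /= nm; exists m.
  exact: (nbhs_translate l (seminorm_nbhs0 srho crho h2)).
move=> [_ [[m /= nm <-] ml]].
have SmSn : rho (S m - S n) <= M * l1_tail u n.
  rewrite -(subnKC nm); set d := (m - n)%N.
  have -> : S (n + d)%N - S n = \sum_(k < d) u (n + k)%N *: x (n + k)%N.
    by rewrite /S big_split_ord/= addrAC subrr add0r.
  apply: le_trans (seminorm_sum d (fun k => u (n + k)%N *: x (n + k)%N) srho) _.
  have M0 : 0 <= M by apply: le_trans (xM 0%N); exact: seminorm_ge0.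
  apply: le_trans _ (ler_wpM2l M0 (sum_modulus_le_tail u n d)).
  rewrite mulr_sumr; apply: ler_sum => k _.
  by rewrite srho.2 mulrC ler_wpM2r ?modulus_ge0.
have -> : S n - l = (S m - l) - (S m - S n) by rewrite opprB [RHS]addrC addrA subrK.
apply: le_lt_trans (seminormB _ _ srho) _.
have : M * l1_tail u n < 2^-1.
  by near: n; apply: (cvgr_lt 0 rM).
move: ml SmSn => /=; lra.
Unshelve. all: by end_near. Qed.

(** * Finitely supported sequences and the equivalences *)

Section l1_0_facts.
Variables (R : realType) (s : scalars).
Local Notation K := (scalar_field R s).

Lemma unit_vector_in_span i : unit_vector R s i \in @unit_vector_span R s.
Proof.
apply/asboolP; exists i.+1, (fun k => (k == i)%:R).
rewrite big_ord_recr/= eqxx scale1r big1 ?add0r// => k _.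
by rewrite (ltn_eqF (ltn_ord k)) scale0r.
Qed.

Lemma l1_0_finite_support (u : l1_0 R s) :
  exists n, forall k, (n <= k)%N -> (u : l1 R s) k = 0.
Proof.
case: u => v vS; have /asboolP[n [a vE]] := vS.
exists n => k /=; rewrite vE {vS vE v}.
elim: n => [|n IH] nk; first by rewrite big_ord0.
rewrite big_ord_recr/=.
change ((\sum_(i < n) a i *: unit_vector R s i) k + a n * (k == n)%:R = 0).
by rewrite IH ?(ltnW nk)// gtn_eqF// mulr0 addr0.
Qed.

Lemma l1_0_series (E : tvsType K) (x : nat -> E) (u : l1_0 R s) :
  exists l : E, (fun n => \sum_(k < n) (u : l1 R s) k *: x k) @ \oo --> l.
Proof.
have [N uN] := l1_0_finite_support u.
exists (\sum_(k < N) (u : l1 R s) k *: x k); apply: cvg_near_cst; near=> n.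
have Nn : (N <= n)%N by near: n; exists N.
rewrite -(subnKC Nn) big_split_ord/= [X in _ + X]big1 ?addr0// => k _.
by rewrite uN ?scale0r// leq_addr.
Unshelve. all: by end_near. Qed.

End l1_0_facts.

Theorem theorem5p10 (R : realType) (s : scalars) (p q : \bar R)
    (hp : (1%:E <= p)%E) (hpq : (p <= q)%E)
    (E : tvsType (scalar_field R s)) (hE : hausdorff_space E)
    (c : compactness) :
  let i := forall L : normedModType (scalar_field R s),
    adjoint_convergent_in_class c p q L E in
  let ii := adjoint_convergent_in_class c p q (l1_0 R s) E in
  let iii := forall A : set E, limited p q A -> subset_in_class c p A in
  let iv := adjoint_convergent_in_class c p q (l1 R s) E in
  ((i <-> ii) /\ (ii <-> iii)) /\ (locally_complete E -> (iii <-> iv)).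
Proof.
move=> i ii iii iv.
have q1 : (1%:E <= q)%E := le_trans hp hpq.
have iii_i : iii -> i by exact: adjoint_convergent_in_class_of_limited.
have bounded (A : set E) (x : nat -> E) : limited p q A -> (forall n, A (x n)) ->
    forall rho : E -> R, seminorm rho -> continuous rho ->
    exists M, forall n, rho (x n) <= M.
  move=> limA xA rho srho crho.
  have [M AM] := limited_seminorm_bounded hp limA srho crho.
  by exists M => n; apply: AM; exists (x n).
have ii_iii : ii -> iii.
  move=> hii A limA; apply: subset_in_class_dilate => // x xA.
  exact: (@subset_in_class_of_synthesis R s (l1_0 R s) (@l1_0_val R s)
    (fun k => L1_0 (unit_vector_in_span R s k)) (fun _ _ _ => erefl)
    (fun _ => erefl) (fun _ => erefl) E hE x (bounded A x limA xA)
    (l1_0_series x) c p q A).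
have iv_iii : locally_complete E -> iv -> iii.
  move=> lcE hiv A limA; apply: subset_in_class_dilate => // x xA.
  have xb := bounded A x limA xA.
  exact: (@subset_in_class_of_synthesis R s (l1 R s) id (unit_vector R s)
    (fun _ _ _ => erefl) (fun _ => erefl) (fun _ => erefl) E hE x xb (fun u => locally_complete_l1_series u lcE xb) c p q A).
split; first split; first split.
- by move=> hi; exact: hi.
- by move=> /ii_iii/iii_i.
- by split=> [/ii_iii|/iii_i hi]; last exact: hi.
- by move=> lcE; split=> [/iii_i hi|]; [exact: hi|exact: iv_iii].
Qed.
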